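(* Let $(X,\mathcal{A},\mu,T)$ be an ergodic probability preserving system, $(A_l)$ an asymptotically rare sequence in $\mathcal{A}$, and $(\psi_{A_l})_{l\ge1}$ a sequence of $\mathfrak{F}$-valued local observables for the $A_l$ such that $\psi_{A_l}\overset{\mu_{A_l}}{\Longrightarrow}\psi$ as $l\to\infty$ for some random element $\psi$ of $\mathfrak{F}$. Let $\Psi_{A_l}$ be the corresponding local processes. Suppose $\mathcal{B}^\pi_{\mathfrak{F}}$ is a $\pi$-system generating the Borel $\sigma$-algebra of $\mathfrak{F}$ with $\mathfrak{F}\in\mathcal{B}^\pi_{\mathfrak{F}}$, and $\Pr[\psi\in\partial F]=0$ for all $F\in\mathcal{B}^\pi_{\mathfrak{F}}$. Let $\nu_l:=\mu_{A_l}$ and assume that for every $F\in\mathcal{B}^\pi_{\mathfrak{F}}$ with $\Pr[\psi\in F]>0$ there are measurable $\tau_{l,F}:X\to\mathbb{N}_0$, $l\ge1$, such that, with $\nu_{l,F}:=(\nu_l)_{\{\psi_{A_l}\in F\}}$, we have $\nu_{l,F}(\tau_{l,F}<\varphi_{A_l})\to1$ as $l\to\infty$, while there is a compact subset $\mathfrak{K}_F$ of $(\mathfrak{P},d_{\mathfrak{P}})$ with $T^{\tau_{l,F}}_\ast\nu_{l,F}\in\mathfrak{K}_F$ for $l\ge1$. Then $$\widetilde\Psi_{A_l}\overset{\mu_{A_l}}{\Longrightarrow}\Psi^\ast\quad\text{and}\quad\Psi_{A_l}\overset{\mu}{\Longrightarrow}\Psi^\ast\qquad\text{as }l\to\infty,$$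 where $\Psi^\ast=(\psi^{\ast(j)})_{j\ge0}$ is an iid sequence in $\mathfrak{F}$ with $\mathrm{law}(\psi^{\ast(0)})=\mathrm{law}(\psi)$. More generally, this conclusion follows if for every $\varepsilon>0$ there are a sequence $(\nu_l)$ in $\mathfrak{P}$ with $d_{\mathfrak{P}}(\nu_l,\mu_{A_l})<\varepsilon$ for all $l$, and, for every $F\in\mathcal{B}^\pi_{\mathfrak{F}}$ with $\Pr[\psi\in F]>0$, a compact set $\mathfrak{K}_F\subseteq\mathfrak{P}$, measures $\nu_{l,F}\in\mathfrak{P}$ with $d_{\mathfrak{P}}(\nu_{l,F},(\nu_l)_{\{\psi_{A_l}\in F\}})\to0$, and measurable $\tau_{l,F}$ such that $\nu_{l,F}(\tau_{l,F}<\varphi_{A_l})\to1$ and $T^{\tau_{l,F}}_\ast\nu_{l,F}\in\mathfrak{K}_F$ for all $l$.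
   Context: $(\mathfrak{F},d_{\mathfrak{F}})$ compact metric space. For $A$ with $\mu(A)>0$: $\varphi_A(x):=\inf\{n\ge1:T^nx\in A\}$, $T_Ax:=T^{\varphi_A(x)}x$, $\mu_A:=\mu(A\cap\cdot)/\mu(A)$; $\nu_B:=\nu(B\cap\cdot)/\nu(B)$. Asymptotically rare: $0<\mu(A_l)\to0$. Local observable: measurable $\psi_A:A\to\mathfrak{F}$; $\Psi_A:=(\psi_A\circ T_A,\psi_A\circ T_A^2,\ldots):X\to\mathfrak{F}^{\mathbb{N}}$ and $\widetilde\Psi_A:=(\psi_A,\psi_A\circ T_A,\ldots):A\to\mathfrak{F}^{\mathbb{N}_0}$. $\mathfrak{P}$: probabilities $\nu\ll\mu$ with $d_{\mathfrak{P}}(\nu,\nu')=2\sup_A|\nu(A)-\nu'(A)|$. $T^\tau x:=T^{\tau(x)}x$, $T^\tau_\ast\nu:=\nu\circ(T^\tau)^{-1}$. $\partial F$ is the topological boundary. $\overset{\nu}{\Longrightarrow}$: weak convergence of laws under $\nu$. *)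

(* Defs.v *)
From HB Require Import structures.
From mathcomp Require Import all_boot all_order all_algebra.
From mathcomp Require Import all_classical all_reals all_analysis.
Set Implicit Arguments.
Unset Strict Implicit.
Unset Printing Implicit Defensive.
Import Order.TTheory GRing.Theory Num.Theory.
Import numFieldNormedType.Exports.
Local Open Scope classical_set_scope.
Local Open Scope ring_scope.

Notation borelT S := (g_sigma_algebraType (@open S)).

Definition boundary (S : topologicalType) (B : set S) : set S :=
  closure B `\` interior B.

Section Dyn.
Context {R : realType} {d : measure_display} {X : measurableType d}.

Definition measure_preserving (mu : set X -> \bar R) (T : X -> X) :=
  measurable_fun setT T /\
  forall B, measurable B -> mu (T @^-1` B) = mu B.

Definition ergodic (mu : set X -> \bar R) (T : X -> X) :=
  forall B, measurable B -> T @^-1` B = B -> mu B = 0%E \/ mu B = 1%E.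

Definition asymptotically_rare (mu : set X -> \bar R) (A : nat -> set X) :=
  (forall l, measurable (A l)) /\ (forall l, (0 < mu (A l))%E) /\
  ((fun l => mu (A l)) @ \oo --> (0 : \bar R)).

(* first return time phi_A; by convention 0 if x never returns to A
   (a mu-null set for ergodic T and mu A > 0) *)
Definition ret_time (T : X -> X) (A : set X) (x : X) : nat :=
  match pselect (exists n, (0 < n)%N && `[< A (iter n T x) >]) with
  | left h => ex_minn h
  | right _ => 0%N
  end.

Definition induced_map (T : X -> X) (A : set X) (x : X) : X :=
  iter (ret_time T A x) T x.

(* the event {tau < phi_A} (phi_A = +oo if x never returns) *)
Definition before_return (T : X -> X) (A : set X) (tau : X -> nat) : set X :=
  [set x | forall n, (0 < n <= tau x)%N -> ~ A (iter n T x)].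

Definition local_process {S : Type} (T : X -> X) (A : set X) (psi : X -> S)
  (x : X) : nat -> S := fun j => psi (iter j.+1 (induced_map T A) x).

Definition local_process0 {S : Type} (T : X -> X) (A : set X) (psi : X -> S)
  (x : X) : nat -> S := fun j => psi (iter j (induced_map T A) x).

Definition condm (nu : set X -> \bar R) (E : set X) : set X -> \bar R :=
  fun B => (nu (E `&` B) * (nu E)^-1)%E.

Definition cond_int (mu : {measure set X -> \bar R}) (A : set X) (g : X -> R)
  : \bar R := ((\int[mu]_(x in A) (g x)%:E) * (mu A)^-1)%E.

Definition push (T : X -> X) (tau : X -> nat) (nu : set X -> \bar R)
  : set X -> \bar R := fun B => nu [set x | B (iter (tau x) T x)].

Definition Probs (mu : set X -> \bar R) : set (set X -> \bar R) :=
  [set nu | [/\ nu set0 = 0%E,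
             (forall B, measurable B -> (0 <= nu B)%E),
             semi_sigma_additive nu,
             nu setT = 1%E &
             (forall B, measurable B -> mu B = 0%E -> nu B = 0%E)]].

Definition dP (nu nu' : set X -> \bar R) : \bar R :=
  (2%:E * ereal_sup [set `|nu B - nu' B|%E | B in measurable])%E.

Definition openP (mu : set X -> \bar R) (U : set (set X -> \bar R)) :=
  U `<=` Probs mu /\
  forall nu, U nu -> exists2 e : R, 0 < e &
    forall nu', Probs mu nu' -> (dP nu nu' < e%:E)%E -> U nu'.

Definition compactP (mu : set X -> \bar R) (K : set (set X -> \bar R)) :=
  K `<=` Probs mu /\
  forall (I : Type) (U : I -> set (set X -> \bar R)),
    (forall i, openP mu (U i)) -> K `<=` \bigcup_i U i ->
    exists2 J : set I, finite_set J & K `<=` \bigcup_(i in J) U i.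

End Dyn.

Definition iid_with_law_of {R : realType} {F : ptopologicalType}
  {dO : measure_display} {Om : measurableType dO} (P' : probability Om R)
  (Y : Om -> nat -> F)
  {dO' : measure_display} {Om' : measurableType dO'} (P : probability Om' R)
  (psi : Om' -> F) :=
  [/\ (forall j, measurable_fun setT ((fun w => Y w j) : Om -> borelT F)),
      (forall j (B : set (borelT F)), measurable B ->
         P' [set w | B (Y w j)] = P (psi @^-1` B)) &
      (forall (s : seq nat) (B : nat -> set (borelT F)), uniq s ->
         (forall j, measurable (B j)) ->
         P' [set w | forall j, j \in s -> B j (Y w j)] =
         (\prod_(j <- s) P' [set w | B j (Y w j)])%E)].

(* Main.v *)
(* Write A for A_l, M for the law of psi, and V for the event that the local
   process Psi_A lies in a fixed rectangle.

   V is nearly T-invariant: x and T x are both in V or both outside V unless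
   T x is in A.  For a bounded density w this gives
   int_V w ~ int_V w o T^k, hence int_V w ~ int_V (n^-1 sum_(k < n) w o T^k) ~ mu(V) int w
   by the mean ergodic theorem, so nu(V) - mu(V) -> 0 for every nu << mu, and
   uniformly on compact sets of such nu.  Since Psi_A is unchanged by T^tau as long
   as tau < phi_A, the hypothesis on nu_(l,F) yields
   mu_A(psi_A in F, V) - M(F) mu(V) -> 0 for F in the pi-system.  This extends to
   all M-continuity sets F, by approximating 1_F in L^2(M) by combinations of
   indicators of the pi-system.  With F the whole space and the invariance of mu_A
   under T_A, it links mu(V) with the law of the shifted process under mu_A, and an
   induction on the length of the rectangle gives the product limit.  Finally a
   continuous function on the compact product space is a uniform limit of
   combinations of indicators of such rectangles. *)
Require Import Defs.
From HB Require Import structures.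
From mathcomp Require Import all_boot all_order all_algebra.
From mathcomp Require Import all_classical all_reals all_analysis.
From mathcomp Require Import measurable_realfun.
From mathcomp Require Import ring lra zify.
Import Order.TTheory GRing.Theory Num.Theory.
Import numFieldNormedType.Exports.
Local Open Scope classical_set_scope.
Local Open Scope ring_scope.

(** * Bounded measurable functions and the mean ergodic theorem *)

(** The limits in l carry no uniformity over the pi-system, so a Dynkin argument on the asymptotic
    statement itself would break down at countable unions. It is run instead on approximability in
    L^2(M), where a single measure is involved. The error t = 1_C - g must afterwards be controlled
    under the laws of psi_(A_l). This is possible because t^2 is again a combination of indicators
    of M-continuity sets, so that its mu_A-expectation tends to its M-integral; hence the squares,
    and hence the restriction to sets C with M-null boundary. All such C are needed because a
    generating pi-system need not supply small neighbourhoods of points, whereas the open continuity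
    sets do, and compactness of the product space is exploited through them. A second obstacle is
    measurability: the first-return map takes a default value where no return occurs, and psi_A is
    unconstrained outside A. The local processes are therefore handled only on a set of full
    measure, and the integrals are transferred to it. *)

Definition bmf {R : realType} {d : measure_display} {Y : measurableType d}
  (f : Y -> R) := measurable_fun setT f /\ exists M : R, forall x, `|f x| <= M.

Section bmf.
Context {R : realType} {d : measure_display} {Y : measurableType d}.
Implicit Types f g : Y -> R.

Lemma bmf_cst (c : R) : bmf (fun _ : Y => c).
Proof. by split; [exact: measurable_cst | exists `|c|]. Qed.

Lemma bmfD f g : bmf f -> bmf g -> bmf (fun x => f x + g x).
Proof.
move=> [mf [M fM]] [mg [N gN]]; split; first exact: measurable_funD.
by exists (M + N) => x; rewrite (le_trans (ler_normD _ _))// lerD.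
Qed.

Lemma bmfM f g : bmf f -> bmf g -> bmf (fun x => f x * g x).
Proof.
move=> [mf [M fM]] [mg [N gN]]; split; first exact: measurable_funM.
by exists (M * N) => x; rewrite normrM ler_pM.
Qed.

Lemma bmfN f : bmf f -> bmf (fun x => - f x).
Proof.
move=> [mf [M fM]]; split; first exact: measurableT_comp.
by exists M => x; rewrite normrN.
Qed.

Lemma bmfB f g : bmf f -> bmf g -> bmf (fun x => f x - g x).
Proof. by move=> bf bg; apply: bmfD => //; exact: bmfN. Qed.

Lemma bmf_norm f : bmf f -> bmf (fun x => `|f x|).
Proof.
move=> [mf [M fM]]; split; first exact: measurableT_comp.
by exists M => x; rewrite normr_id.
Qed.

Lemma bmf_indic (B : set Y) : measurable B -> bmf (\1_B : Y -> R).
Proof.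
move=> mB; split; first exact: measurable_indic.
by exists 1 => x; rewrite indicE; case: (_ \in _); rewrite ?normr1 ?normr0.
Qed.

Lemma bmf_max f g : bmf f -> bmf g -> bmf (fun x => Num.max (f x) (g x)).
Proof.
move=> [mf [M fM]] [mg [N gN]]; split; first exact: measurable_maxr.
exists (Num.max M N) => x; rewrite le_max.
by have [_|_] := leP (f x) (g x); rewrite ?gN ?fM ?orbT.
Qed.

Lemma bmf_sum (I : Type) (s : seq I) (h : I -> Y -> R) :
  (forall i, bmf (h i)) -> bmf (fun x => \sum_(i <- s) h i x).
Proof.
move=> bh; elim: s => [|i s IH].
  by under eq_fun do rewrite big_nil; exact: bmf_cst.
by under eq_fun do rewrite big_cons; exact: bmfD.
Qed.

End bmf.

Lemma bmf_comp {R : realType} {d d' : measure_display} {Y : measurableType d}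
  {Z : measurableType d'} (f : Z -> R) (h : Y -> Z) :
  bmf f -> measurable_fun setT h -> bmf (fun x => f (h x)).
Proof.
move=> [mf [M fM]] mh; split; first exact: measurableT_comp.
by exists M.
Qed.

(** Stated for bare set functions because [condm], [push] and the elements of [Probs] are not
    bundled measures; [fine] loses nothing on sets of finite mass. *)
Definition pr {R : realType} {d : measure_display} {Y : measurableType d}
  (m : set Y -> \bar R) (B : set Y) : R := fine (m B).

Section prob.
Context {R : realType} {d : measure_display} {Y : measurableType d}
  (m : probability Y R).
Implicit Types (f g : Y -> R) (B C : set Y).

Lemma prE B : measurable B -> m B = (pr m B)%:E.
Proof. by move=> mB; rewrite /pr fineK// fin_num_measure. Qed.

Lemma pr_ge0 B : 0 <= pr m B.
Proof. exact: fine_ge0. Qed.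

Lemma pr_le1 B : measurable B -> pr m B <= 1.
Proof. by move=> mB; rewrite -lee_fin -prE// probability_le1. Qed.

Lemma pr_setT : pr m setT = 1.
Proof. by rewrite /pr probability_setT. Qed.

Lemma pr_set0 : pr m set0 = 0.
Proof. by rewrite /pr measure0. Qed.

Lemma le_pr B C : measurable B -> measurable C -> B `<=` C -> pr m B <= pr m C.
Proof.
by move=> mB mC BC; rewrite -lee_fin -!prE// le_measure// inE.
Qed.

Lemma pr_eq0 B C : measurable B -> measurable C -> B `<=` C -> pr m C = 0 ->
  pr m B = 0.
Proof.
move=> mB mC BC C0; apply/eqP; rewrite eq_le pr_ge0 andbT -C0; exact: le_pr.
Qed.

Lemma pr_setU B C : measurable B -> measurable C -> B `&` C = set0 ->
  pr m (B `|` C) = pr m B + pr m C.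
Proof.
move=> mB mC BC; apply: EFin_inj; rewrite EFinD -!prE ?measureU//.
exact: measurableU.
Qed.

Lemma pr_setC B : measurable B -> pr m (~` B) = 1 - pr m B.
Proof.
move=> mB; rewrite -pr_setT -(setUv B) pr_setU ?setICr//; last exact: measurableC.
ring.
Qed.

Lemma pr_split B C : measurable B -> measurable C ->
  pr m B = pr m (B `&` C) + pr m (B `&` ~` C).
Proof.
move=> mB mC; rewrite -pr_setU -?setIUr ?setUv ?setIT//.
- exact: measurableI.
- by apply: measurableI => //; exact: measurableC.
- by rewrite setIACA setICr setI0.
Qed.

Lemma pr_setU_le B C : measurable B -> measurable C ->
  pr m (B `|` C) <= pr m B + pr m C.
Proof.
move=> mB mC; have -> : B `|` C = B `|` (C `&` ~` B).
  by rewrite setUIr setUv setIT.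
have mD : measurable (C `&` ~` B) by apply: measurableI => //; exact: measurableC.
rewrite pr_setU//; last by rewrite setIC -setIA setICl setI0.
by rewrite lerD2l le_pr.
Qed.

Lemma pr_symdiff B C D : measurable B -> measurable C -> measurable D ->
  (forall x, ~ D x -> B x <-> C x) -> `|pr m B - pr m C| <= pr m D.
Proof.
move=> mB mC mD BC.
have H B1 C1 : measurable B1 -> measurable C1 -> (forall x, ~ D x -> B1 x -> C1 x) ->
    pr m B1 - pr m C1 <= pr m D.
  move=> mB1 mC1 BC1; rewrite lerBlDl (le_trans _ (pr_setU_le _ _ mC1 mD))// le_pr//.
    exact: measurableU.
  by move=> x Bx; have [Dx|Dx] := pselect (D x); [right|left; exact: BC1].
have h1 : pr m B - pr m C <= pr m D by apply: H => // x /BC[].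
have h2 : pr m C - pr m B <= pr m D by apply: H => // x /BC[].
by rewrite ler_norml; apply/andP; split => //; lra.
Qed.

Lemma bmf_integrable f : bmf f -> m.-integrable setT (EFin \o f).
Proof.
move=> [mf [M fM]]; apply: measurable_bounded_integrable => //.
  by rewrite -ge0_fin_numE// fin_num_measure.
exists M; split; first exact: num_real.
by move=> N MN x _ /=; rewrite (le_trans (fM x))// ltW.
Qed.

Lemma RintD f g : bmf f -> bmf g ->
  \int[m]_x (f x + g x) = \int[m]_x f x + \int[m]_x g x.
Proof. by move=> bf bg; rewrite RintegralD//; exact: bmf_integrable. Qed.

Lemma RintB f g : bmf f -> bmf g ->
  \int[m]_x (f x - g x) = \int[m]_x f x - \int[m]_x g x.
Proof. by move=> bf bg; rewrite RintegralB//; exact: bmf_integrable. Qed.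

Lemma RintZ c f : bmf f -> \int[m]_x (c * f x) = c * \int[m]_x f x.
Proof. by move=> bf; rewrite RintegralZl//; exact: bmf_integrable. Qed.

Lemma Rint_cst (c : R) : \int[m]_x c = c.
Proof. by rewrite Rintegral_cst// (_ : fine _ = 1) ?mulr1//; exact: pr_setT. Qed.

Lemma Rint_sum (I : Type) (s : seq I) (h : I -> Y -> R) :
  (forall i, bmf (h i)) ->
  \int[m]_x (\sum_(i <- s) h i x) = \sum_(i <- s) \int[m]_x h i x.
Proof.
move=> bh; elim: s => [|i s IH].
  by under eq_Rintegral do rewrite big_nil; rewrite Rint_cst big_nil.
under eq_Rintegral do rewrite big_cons.
by rewrite RintD ?IH ?big_cons//; exact: bmf_sum.
Qed.

Lemma le_Rint f g : bmf f -> bmf g -> (forall x, f x <= g x) ->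
  \int[m]_x f x <= \int[m]_x g x.
Proof. by move=> bf bg fg; apply: le_Rintegral => //; exact: bmf_integrable. Qed.

Lemma Rint_norm f : bmf f -> `|\int[m]_x f x| <= \int[m]_x `|f x|.
Proof. by move=> bf; apply: le_normr_Rintegral => //; exact: bmf_integrable. Qed.

Lemma Rint_indic B : measurable B -> \int[m]_x \1_B x = pr m B.
Proof. by move=> mB; rewrite /Rintegral integral_indic// setIT. Qed.

End prob.

Lemma pr_nondecreasing_cvg {R : realType} {d' : measure_display} {Y : measurableType d'}
  (m : probability Y R) (B : nat -> set Y) : (forall n, measurable (B n)) ->
  nondecreasing_seq B -> pr m (B n) @[n --> \oo] --> pr m (\bigcup_n B n).
Proof.
move=> mB ndB; have mU : measurable (\bigcup_n B n) by exact: bigcup_measurable.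
rewrite /pr; apply: fine_cvg; rewrite fineK ?fin_num_measure//.
exact: nondecreasing_cvg_mu.
Qed.

Lemma pr_nonincreasing_cvg {R : realType} {d' : measure_display} {Y : measurableType d'}
  (m : probability Y R) (B : nat -> set Y) : (forall n, measurable (B n)) ->
  nonincreasing_seq B -> pr m (B n) @[n --> \oo] --> pr m (\bigcap_n B n).
Proof.
move=> mB niB; have mU : measurable (\bigcap_n B n) by exact: bigcapT_measurable.
rewrite /pr; apply: fine_cvg; rewrite fineK ?fin_num_measure//.
by apply: nonincreasing_cvg_mu => //; rewrite -ge0_fin_numE// fin_num_measure.
Qed.

Lemma ex_nat_gt {R : realType} (x : R) : exists n : nat, x < n%:R.
Proof.
by exists (Num.bound `|x|); rewrite (le_lt_trans (ler_norm _))// archi_boundP.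
Qed.

Lemma indic_ge0 {R : realType} {Y : Type} (B : set Y) x : 0 <= (\1_B x : R).
Proof. by rewrite indicE; case: (_ \in _). Qed.

Lemma indic_le1 {R : realType} {Y : Type} (B : set Y) x : (\1_B x : R) <= 1.
Proof. by rewrite indicE; case: (_ \in _). Qed.

Lemma indic1 {R : realType} {Y : Type} (B : set Y) x : B x -> \1_B x = 1 :> R.
Proof. by move=> Bx; rewrite indicE mem_set. Qed.

Lemma indic0N {R : realType} {Y : Type} (B : set Y) x : ~ B x -> \1_B x = 0 :> R.
Proof. by move=> Bx; rewrite indicE memNset. Qed.

Lemma measurable_set_gt {R : realType} {d' : measure_display} {Y : measurableType d'}
  (f : Y -> R) c : measurable_fun setT f -> measurable [set x | c < f x].
Proof.
move=> mf; have := mf measurableT `]c, +oo[%classic (measurable_itv _).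
by rewrite setTI; congr measurable; apply/seteqP; split => x /=; rewrite in_itv/= andbT.
Qed.

Section birkhoff_sums.
Context {R : realType} {d : measure_display} {X : measurableType d} (T : X -> X).

Lemma measurable_iter k : measurable_fun setT T -> measurable_fun setT (iter k T).
Proof.
move=> mT; elim: k => [|k IH]; first exact: measurable_id.
exact: (measurableT_comp mT IH).
Qed.

Lemma measurable_preT B : measurable_fun setT T -> measurable B -> measurable (T @^-1` B).
Proof. by move=> mT mB; rewrite -[X in measurable X]setTI; exact: mT. Qed.

Lemma measurable_preiter k B : measurable_fun setT T -> measurable B -> measurable (iter k T @^-1` B).
Proof. by move=> mT mB; rewrite -[X in measurable X]setTI; exact: measurable_iter. Qed.

Definition bsum (f : X -> R) n x := \sum_(k < n) f (iter k T x).

Lemma bsumS (f : X -> R) n x : bsum f n.+1 x = f x + bsum f n (T x).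
Proof.
rewrite /bsum big_ord_recl/=; congr (_ + _).
by apply: eq_bigr => i _; rewrite -iterSr.
Qed.

Lemma bmf_bsum (f : X -> R) n : measurable_fun setT T -> bmf f -> bmf (bsum f n).
Proof.
move=> mT bf; apply: bmf_sum => k; apply: bmf_comp => //; exact: measurable_iter.
Qed.

End birkhoff_sums.

Lemma Rint_push {R : realType} {d d' : measure_display} {Y : measurableType d}
  {Z : measurableType d'} (m : probability Y R) (m' : probability Z R) (h : Y -> Z)
  (f : Z -> R) : measurable_fun setT h ->
  (forall B, measurable B -> m (h @^-1` B) = m' B) -> bmf f ->
  \int[m']_x f x = \int[m]_x f (h x).
Proof.
move=> mh hE bf; have mf : measurable_fun setT (fun x => (f x)%:E : \bar R).
  by apply/measurable_EFinP; case: bf.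
have ih : m.-integrable setT ((EFin \o f) \o h).
  by apply: (bmf_integrable m (f \o h)); exact: bmf_comp.
rewrite /Rintegral; congr fine.
transitivity (\int[pushforward m h]_x (f x)%:E)%E.
  by apply: eq_measure_integral => B mB _; exact/esym/hE.
by rewrite (integral_pushforward (D := setT) mh mf).
Qed.

Section ergodic_theorem.
Context {R : realType} {d : measure_display} {X : measurableType d}
  (mu : probability X R) (T : X -> X).
Hypothesis mpT : measure_preserving mu T.
Hypothesis ergT : ergodic mu T.

Let mT : measurable_fun setT T. Proof. by case: mpT. Qed.

Lemma pr_preT B : measurable B -> pr mu (T @^-1` B) = pr mu B.
Proof. by move=> mB; rewrite /pr; congr fine; apply: (mpT.2). Qed.

Lemma pr_preiter k B : measurable B -> pr mu (iter k T @^-1` B) = pr mu B.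
Proof.
move=> mB; elim: k => [//|k IH].
rewrite -IH -[RHS]pr_preT; last exact: measurable_preiter.
by congr (pr mu _); apply/seteqP; split => x; rewrite /preimage/= -iterSr.
Qed.

Lemma Rint_T (f : X -> R) : bmf f -> \int[mu]_x f (T x) = \int[mu]_x f x.
Proof. by move=> bf; rewrite [RHS](Rint_push mu mu T)//; case: mpT. Qed.

Lemma Rint_iter k (f : X -> R) : bmf f ->
  \int[mu]_x f (iter k T x) = \int[mu]_x f x.
Proof.
move=> bf; elim: k => [//|k <-].
under eq_Rintegral do rewrite iterSr.
rewrite (Rint_T (fun x => f (iter k T x)))//; apply: bmf_comp => //.
exact: measurable_iter.
Qed.

(* The maximum of the Birkhoff sums [bsum f k], [k <= n], in the recursive form that
   makes the maximal inequality telescope. *)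
Fixpoint msum (f : X -> R) n x : R :=
  if n is n'.+1 then Num.max 0 (f x + msum f n' (T x)) else 0.

Lemma msum_ge0 f n x : 0 <= msum f n x.
Proof. by case: n => //= n; rewrite le_max lexx. Qed.

Lemma msum_nd f n x : msum f n x <= msum f n.+1 x.
Proof.
elim: n x => [x|n IH x]; first exact: msum_ge0.
rewrite [leRHS]/= [leLHS]/= le_max2// lerD2l; exact: IH.
Qed.

Lemma bmf_msum f n : bmf f -> bmf (msum f n).
Proof.
move=> bf; elim: n => [|n IH]; first exact: bmf_cst.
by apply: bmf_max; [exact: bmf_cst|apply: bmfD => //; exact: bmf_comp].
Qed.

Lemma bsum_le_msum f n x : bsum T f n x <= msum f n x.
Proof.
elim: n x => [x|n IH x]; first by rewrite /bsum big_ord0.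
by rewrite bsumS/= le_max lerD2l IH orbT.
Qed.

(** Garsia's argument. Write S for [msum f n]. Where S > 0, its recursion and monotonicity in n give
    S x <= f x + S (T x); elsewhere S x = 0 <= S (T x). So the integrand dominates S - S o T, whose
    integral vanishes by invariance. *)
Lemma maximal_ergodic f n : bmf f ->
  0 <= \int[mu]_x (\1_[set y | 0 < msum f n y] x * f x).
Proof.
move=> bf; have bM k : bmf (msum f k) by exact: bmf_msum.
have bI : bmf (\1_[set y | 0 < msum f n y] : X -> R).
  by apply: bmf_indic; apply: measurable_set_gt; case: (bM n).
have : \int[mu]_x (msum f n x - msum f n (T x)) = 0.
  by rewrite RintB//; [rewrite Rint_T// subrr|exact: bmf_comp].
move=> h; rewrite -[leLHS]h; apply: le_Rint => //.
- by apply: bmfB => //; exact: bmf_comp.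
- exact: bmfM.
move=> x; have [pos|npos] := ltP 0 (msum f n x); last first.
  rewrite indic0N; last by rewrite /= ltNge npos.
  by rewrite mul0r subr_le0 (le_trans npos)// msum_ge0.
rewrite indic1// mul1r; case: n pos {bI h} => [|n]; first by rewrite /= ltxx.
have := msum_nd f n (T x).
move=> /=; set a := msum f n (T x); set b := Num.max _ (_ + msum f n _).
by move=> ab; case: (leP 0 (f x + a)) => h; lra.
Qed.

Lemma pr_invariant B : measurable B -> T @^-1` B = B -> pr mu B = 0 \/ pr mu B = 1.
Proof.
move=> mB BB; rewrite /pr; have [->|->] := ergT _ mB BB; by [left|right].
Qed.

(** Unboundedness from above is an invariant property, so it has mass 0 or 1. With mass 1 the sets
    where [msum f n] is positive would exhaust the space, and the maximal inequality would
    contradict the negative integral of f. *)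
Lemma bsum_bounded_ae f : bmf f -> \int[mu]_x f x < 0 ->
  pr mu [set x | forall N : nat, exists n, N%:R < bsum T f n x] = 0.
Proof.
move=> bf f0; set I := [set x | _].
have mI : measurable I.
  have -> : I = \bigcap_N \bigcup_n [set x | N%:R < bsum T f n x].
    apply/seteqP; split => x /= h N => [_|]; first by have [n ?] := h N; exists n.
    by have [n _ ?] := h N Logic.I; exists n.
  apply: bigcapT_measurable => N; apply: bigcupT_measurable => n.
  by apply: measurable_set_gt; case: (bmf_bsum T f n mT bf).
have [mf [C fC]] := bf.
have fC1 x : f x <= C by rewrite (le_trans _ (fC x))// ler_norm.
have fC2 x : - C <= f x by rewrite lerNl (le_trans _ (fC x))// -normrN ler_norm.
(* [K] raises the threshold to absorb the single term [f x] by which the sums at x and at T x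
   differ. *)
have [K CK] := ex_nat_gt C.
have II : T @^-1` I = I.
  apply/seteqP; split => x /= h N.
    have [n hn] := h (N + K)%N; exists n.+1; rewrite bsumS.
    by move: hn (fC2 x); rewrite natrD; lra.
  have [[|n] hn] := h (N + K)%N.
    by move: hn; rewrite /bsum big_ord0 ltNge ler0n.
  by exists n; move: hn (fC1 x); rewrite natrD bsumS; lra.
have [//|I1] := pr_invariant I mI II.
pose E n := [set y | 0 < msum f n y].
have mE n : measurable (E n).
  by apply: measurable_set_gt; case: (bmf_msum f n bf).
have ndE : nondecreasing_seq E.
  apply/nondecreasing_seqP => n; apply/subsetPset => x /= /lt_le_trans; apply.
  exact: msum_nd.
have cE : pr mu (E n) @[n --> \oo] --> (1 : R).
  suff <- : pr mu (\bigcup_n E n) = 1 by exact: pr_nondecreasing_cvg.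
  have mU : measurable (\bigcup_n E n) by exact: bigcup_measurable.
  apply/eqP; rewrite eq_le pr_le1//= -I1 le_pr// => x /(_ 0%N)[n hn].
  by exists n => //; rewrite /E/= (lt_le_trans hn)// bsum_le_msum.
pose a := - \int[mu]_x f x.
have C0 : 0 <= C by rewrite (le_trans _ (fC point)).
(* The integral of f over [E n] is at most -a + C times the mass of the complement, so this
   tolerance makes it negative. *)
have /cvgrPdist_lt/(_ (a / (C + 1))) : pr mu (E n) @[n --> \oo] --> (1 : R) by [].
have a0 : 0 < a by rewrite /a oppr_gt0.
have C1 : 0 < C + 1 by lra.
move=> /(_ (divr_gt0 a0 C1))[n _ /(_ n (leqnn n))]/=.
rewrite -pr_setC// ger0_norm ?pr_ge0// ltr_pdivlMr// => h.
have mEC : measurable (~` E n) by exact: measurableC.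
have := maximal_ergodic f n bf.
have : \int[mu]_x (\1_(E n) x * f x) <= \int[mu]_x (f x + C * \1_(~` E n) x).
  apply: le_Rint.
  - by apply: bmfM => //; exact: bmf_indic.
  - by apply: bmfD => //; apply: bmfM; [exact: bmf_cst|exact: bmf_indic].
  move=> x; have [Ex|Ex] := pselect (E n x).
    by rewrite indic1// [X in C * X]indic0N; [lra|apply].
  by rewrite indic0N// indic1//; move: (fC2 x); lra.
rewrite RintD//; last by apply: bmfM; [exact: bmf_cst|exact: bmf_indic].
rewrite RintZ; last exact: bmf_indic.
rewrite Rint_indic//.
have := pr_ge0 mu (~` E n); move: h; rewrite /a; nra.
Qed.

(** A one-sided bound suffices: the deviation h has integral 0, so |h| = 2 h^+ - h has the integral
    of 2 h^+. The Birkhoff sums of w - (m + e/8) stay below some N off a small set, and a large n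
    makes N / n negligible there. A single n is all that is used later. *)
Lemma mean_ergodic (w : X -> R) (e : R) : bmf w -> 0 < e -> exists2 n, (0 < n)%N &
  \int[mu]_x `|n%:R^-1 * bsum T w n x - \int[mu]_y w y| <= e.
Proof.
move=> bw e0; set m := \int[mu]_y w y.
pose f x := w x - (m + e / 8).
have bf : bmf f by apply: bmfB => //; exact: bmf_cst.
have If : \int[mu]_x f x < 0.
  rewrite RintB//; last exact: bmf_cst.
  by rewrite Rint_cst -/m; lra.
have := bsum_bounded_ae f bf If; set I := [set x | _] => I0.
have [mf [C fC]] := bf.
have C0 : 0 <= C by rewrite (le_trans _ (fC point)).
pose G (N : nat) := \bigcap_n [set x | bsum T f n x <= N%:R].
have mG N : measurable (G N).
  apply: bigcapT_measurable => n.
  rewrite (_ : [set x | _] = ~` [set x | N%:R < bsum T f n x]).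
    by apply: measurableC; apply: measurable_set_gt; case: (bmf_bsum T f n mT bf).
  by apply/seteqP; split => x /=; rewrite leNgt => /negP.
have ndG : nondecreasing_seq G.
  apply/nondecreasing_seqP => n; apply/subsetPset => x /= h k _.
  by rewrite /= (le_trans (h k Logic.I))// ler_nat.
have mU : measurable (\bigcup_n G n) by exact: bigcup_measurable.
have GI : ~` (\bigcup_n G n) = I.
  apply/seteqP; split => x /=.
    move=> h N; apply: contrapT => hN; apply: h; exists N => // n _ /=.
    by rewrite leNgt; apply/negP => hn; apply: hN; exists n.
  by move=> h [N _ hN]; have [n] := h N; rewrite ltNge (hN n).
have U1 : pr mu (\bigcup_n G n) = 1.
  by have := pr_setC mu _ mU; rewrite GI I0; lra.
have C1 : 0 < C + 1 by lra.
have e8 : 0 < e / 8 by lra.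
have := pr_nondecreasing_cvg mu G mG ndG; rewrite U1 => /cvgrPdist_lt.
move=> /(_ _ (divr_gt0 e8 C1))[N _ /(_ N (leqnn N))]/=.
rewrite -pr_setC// ger0_norm ?pr_ge0// ltr_pdivlMr// => hN.
have mGC : measurable (~` G N) by exact: measurableC.
have [n hn] := ex_nat_gt (8 * N%:R / e).
have n0 : (0 : R) < n%:R by rewrite (le_lt_trans _ hn)// divr_ge0 ?mulr_ge0// ltW.
exists n; first by rewrite -(ltr0n R).
pose h x := n%:R^-1 * bsum T w n x - m.
have bh : bmf h.
  apply: bmfB; last exact: bmf_cst.
  by apply: bmfM; [exact: bmf_cst|exact: bmf_bsum].
have Ih : \int[mu]_x h x = 0.
  rewrite RintB//; [|by apply: bmfM; [exact: bmf_cst|exact: bmf_bsum]|exact: bmf_cst].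
  rewrite RintZ; last exact: bmf_bsum.
  rewrite Rint_cst /bsum Rint_sum; last first.
    move=> k; apply: bmf_comp => //; exact: measurable_iter.
  under eq_bigr do rewrite Rint_iter//.
  rewrite sumr_const card_ord -/m -[m *+ n]mulr_natl mulrA mulVf ?mul1r ?subrr//.
  exact: lt0r_neq0.
have hE x : h x = n%:R^-1 * bsum T f n x + e / 8.
  rewrite /h /f /bsum sumrB sumr_const card_ord -[(m + e / 8) *+ n]mulr_natl.
  by rewrite mulrBr mulrA mulVf ?mul1r; [lra|exact: lt0r_neq0].
have hb x : `|h x| <= e / 2 + 2 * C * \1_(~` G N) x - h x.
  have : h x <= e / 4 + C * \1_(~` G N) x.
    rewrite hE; have [Gx|Gx] := pselect (G N x).
      rewrite indic0N; last by apply.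
      have : n%:R^-1 * bsum T f n x <= e / 8; last by lra.
      rewrite ler_pdivrMl//; apply: (le_trans (Gx n Logic.I)).
      move: hn; rewrite ltr_pdivrMr//; lra.
    rewrite indic1//.
    have : n%:R^-1 * bsum T f n x <= C; last by lra.
    have -> : C = n%:R^-1 * \sum_(k < n) C.
      by rewrite sumr_const card_ord -[C *+ n]mulr_natl mulKf// lt0r_neq0.
    rewrite ler_pM2l ?invr_gt0// ler_sum//.
    by move=> k _; rewrite (le_trans _ (fC (iter k T x)))// ler_norm.
  by have := indic_ge0 (R := R) (~` G N) x; case: (ler0P (h x)) => _; nra.
have bI : bmf (fun x => 2 * C * \1_(~` G N) x : R).
  by apply: bmfM; [exact: bmf_cst|exact: bmf_indic].
apply: (@le_trans _ _ (\int[mu]_x (e / 2 + 2 * C * \1_(~` G N) x - h x))).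
  apply: le_Rint => //; first exact: bmf_norm.
  by apply: bmfB => //; apply: bmfD => //; exact: bmf_cst.
rewrite RintB//; last by apply: bmfD => //; exact: bmf_cst.
rewrite Ih RintD//; last exact: bmf_cst.
rewrite Rint_cst RintZ; last exact: bmf_indic.
rewrite Rint_indic//.
by have := pr_ge0 mu (~` G N); nra.
Qed.

End ergodic_theorem.

(** * Asymptotic T-invariance *)

Lemma Rint_restrict {R : realType} {d : measure_display} {Y : measurableType d}
  (m : probability Y R) (B : set Y) (f : Y -> R) :
  \int[m]_x (\1_B x * f x) = \int[m]_(x in B) f x.
Proof.
rewrite [RHS]Rintegral_mkcond; apply: eq_Rintegral => x _.
by rewrite patchE indicE; case: (_ \in _); rewrite ?mul1r ?mul0r.
Qed.

Section density.
Context {R : realType} {d : measure_display} {X : measurableType d}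
  (mu nu : probability X R).
Import HBNNSimple.

(** [w] is a simple function below the Radon-Nikodym density with integral above 1 - e. The lower
    bound is monotonicity; the upper bound is the lower bound for the complement of B. Boundedness
    of [w] is what makes the cost of a shift proportional to the mass of A. *)
Lemma density_approx (e : R) : nu `<< mu -> 0 < e ->
  exists2 w : X -> R, bmf w & (forall x, 0 <= w x) /\
    forall B, measurable B ->
      \int[mu]_x (\1_B x * w x) <= pr nu B <= \int[mu]_x (\1_B x * w x) + e.
Proof.
move=> numu e0.
have [f [f0 intf fE]] := @radon_nikodym_finite _ _ _ mu nu numu.
have fT : (\int[mu]_x f x = 1)%E.
  by rewrite -fE//; exact: probability_setT.
have [h hf hS] : exists2 h : {nnsfun X >-> R}, (forall x, ((h x)%:E <= f x)%E) &
    ((1 - e)%:E < sintegral mu h)%E.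
  have : ((1 - e)%:E < \int[mu]_x f x)%E by rewrite fT lte_fin; lra.
  by rewrite ge0_integralTE// => /ereal_sup_gt[_ [h hf <-]] ?; exists h.
have h0 x : 0 <= h x by exact: fun_ge0.
have bh : bmf h.
  split => //; have [M [_ hM]] := simple_bounded h.
  by exists (M + 1) => x; apply: hM => //; rewrite ltrDl.
have hT : 1 - e < \int[mu]_x h x.
  rewrite -lte_fin (lt_le_trans hS)// -integralT_nnsfun /Rintegral fineK//.
  exact: (integrable_fin_num measurableT (bmf_integrable mu h bh)).
exists h => //; split => // B mB.
have low C : measurable C -> \int[mu]_x (\1_C x * h x) <= pr nu C.
  move=> mC; rewrite Rint_restrict -lee_fin -prE// fE// /Rintegral fineK; last first.
    apply: integrable_fin_num => //; apply: (integrableS measurableT) => //.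
    exact: bmf_integrable.
  apply: ge0_le_integral => //.
  - by move=> x _; rewrite lee_fin.
  - apply/measurable_EFinP; apply: measurable_funTS; by case: bh.
  - by apply: measurable_funTS; exact: measurable_int intf.
have mBC : measurable (~` B) by exact: measurableC.
rewrite low//=.
have := low _ mBC; rewrite pr_setC//.
have : \int[mu]_x h x = \int[mu]_x (\1_B x * h x) + \int[mu]_x (\1_(~` B) x * h x).
  rewrite -RintD; [|by apply: bmfM => //; exact: bmf_indic..].
  apply: eq_Rintegral => x _; rewrite -mulrDl.
  have [Bx|Bx] := pselect (B x).
    by rewrite indic1// [X in _ + X]indic0N ?addr0 ?mul1r//; apply.
  by rewrite indic0N// indic1// add0r mul1r.
lra.
Qed.

End density.

Section asymptotic_invariance.
Context {R : realType} {d : measure_display} {X : measurableType d}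
  (mu : probability X R) (T : X -> X).
Hypothesis mpT : measure_preserving mu T.
Hypothesis ergT : ergodic mu T.

Let mT : measurable_fun setT T. Proof. by case: mpT. Qed.

(** By invariance, composing both factors of the integrand with T leaves the integral unchanged;
    then [\1_E] composed with T differs from [\1_E] only on the preimage of A, so replacing it costs
    at most C mu(A) per shift. *)
Lemma shift_density (w : X -> R) (C : R) (A E : set X) k :
  measurable_fun setT w -> (forall x, `|w x| <= C) ->
  measurable A -> measurable E -> (forall x, ~ A (T x) -> E x <-> E (T x)) ->
  `|\int[mu]_x (\1_E x * w x) - \int[mu]_x (\1_E x * w (iter k T x))|
    <= k%:R * (C * pr mu A).
Proof.
move=> mw wC mA mE EA; have bw : bmf w by split => //; exists C.
have bwk j : bmf (fun x => w (iter j T x)).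
  by apply: bmf_comp => //; exact: measurable_iter.
have bE : bmf (\1_E : X -> R) by exact: bmf_indic.
have bET : bmf (fun x => \1_E (T x) : R) by exact: bmf_comp.
have mTA : measurable (T @^-1` A) by exact: measurable_preT.
have bA : bmf (\1_(T @^-1` A) : X -> R) by exact: bmf_indic.
elim: k => [|k IH]; first by rewrite subrr normr0 mul0r.
have step : `|\int[mu]_x (\1_E x * w (iter k T x)) -
    \int[mu]_x (\1_E x * w (iter k.+1 T x))| <= C * pr mu A.
  rewrite -(Rint_T _ _ mpT (fun x => \1_E x * w (iter k T x))); last exact: bmfM.
  have -> : \int[mu]_x (\1_E (T x) * w (iter k T (T x))) =
            \int[mu]_x (\1_E (T x) * w (iter k.+1 T x)).
    by apply: eq_Rintegral => x _; rewrite -iterSr.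
  rewrite -RintB; [|exact: bmfM|exact: bmfM].
  apply: (le_trans (Rint_norm _ _ _)); first by apply: bmfB; exact: bmfM.
  rewrite -(pr_preT _ _ mpT A mA) -Rint_indic// -RintZ//.
  apply: le_Rint; first by apply: bmf_norm; apply: bmfB; exact: bmfM.
    by apply: bmfM => //; exact: bmf_cst.
  move=> x; rewrite -mulrBl normrM mulrC; have := wC (iter k.+1 T x).
  have [Ax|Ax] := pselect (A (T x)).
    rewrite [X in C * X]indic1// mulr1; apply: le_trans.
    have : `|\1_E (T x) - \1_E x| <= 1 :> R.
      by rewrite !indicE; do 2 case: (_ \in _); rewrite ?subrr ?subr0 ?sub0r ?normrN ?normr1 ?normr0.
    by move=> /(ler_wpM2l (normr_ge0 (w (iter k.+1 T x)))); rewrite mulr1.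
  rewrite [X in C * X]indic0N// mulr0 => _.
  have -> : \1_E (T x) = \1_E x :> R.
    have [ET TE] := EA x Ax.
    have [Ex|Ex] := pselect (E x); first by rewrite !indic1//; exact: ET.
    by rewrite !indic0N// => /TE.
  by rewrite subrr normr0 mulr0.
rewrite -natr1 mulrDl mul1r.
move: IH step; set a := (\int[mu]__ _); set b := (\int[mu]__ _).
set c := (\int[mu]__ _) => IH step.
have -> : a - c = (a - b) + (b - c) by ring.
by rewrite (le_trans (ler_normD _ _))// lerD.
Qed.

(** The averaging length n depends on w alone and is fixed before l varies, so the shifts cost at
    most n C mu(A_l), which tends to 0. *)
Lemma ac_asymptotics (A E : nat -> set X) (nu : probability X R) (e : R) :
  (forall l, measurable (A l)) -> (forall l, measurable (E l)) ->
  pr mu (A l) @[l --> \oo] --> (0 : R) ->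
  (forall l x, ~ A l (T x) -> E l x <-> E l (T x)) ->
  nu `<< mu -> 0 < e ->
  \forall l \near \oo, `|pr nu (E l) - pr mu (E l)| <= e.
Proof.
move=> mA mE A0 EA numu e0.
have e8 : 0 < e / 8 by lra.
have [w bw [w0 wE]] := density_approx mu nu _ numu e8.
have [mw [C wC]] := bw.
have C0 : 0 <= C by rewrite (le_trans _ (wC point)).
have [n n0 hn] := mean_ergodic mu T mpT ergT w (e / 8) bw e8.
have n0R : (0 : R) < n%:R by rewrite ltr0n.
(* The summand 1 keeps the divisor positive when C = 0. *)
pose M := n%:R * C + 1.
have M0 : 0 < M by rewrite /M ltr_wpDl// mulr_ge0// ltW.
have /cvgrPdist_lt/(_ (e / 8 / M) (divr_gt0 e8 M0)) := A0.
apply: filterS => l; rewrite sub0r normrN ger0_norm ?pr_ge0// ltr_pdivlMr// => hl.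
have mEl := mE l.
have bE : bmf (\1_(E l) : X -> R) by exact: bmf_indic.
have bwk j : bmf (fun x => w (iter j T x)).
  by apply: bmf_comp => //; exact: measurable_iter.
have bsn : bmf (bsum T w n) by exact: bmf_bsum.
set m := \int[mu]_y w y in hn.
have /andP[a1 a2] := wE _ mEl; set a := \int[mu]_x _ in a1 a2.
have /andP[t1 t2] : m <= 1 <= m + e / 8.
  have := wE _ measurableT; rewrite pr_setT.
  suff -> : \int[mu]_x (\1_[set: X] x * w x) = m by [].
  by apply: eq_Rintegral => x _; rewrite indic1// mul1r.
pose b := \int[mu]_x (\1_(E l) x * (n%:R^-1 * bsum T w n x)).
have bn : bmf (fun x => n%:R^-1 * bsum T w n x).
  by apply: bmfM => //; exact: bmf_cst.
have ab : `|a - b| <= e / 8.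
  have -> : a - b = n%:R^-1 * \sum_(k < n) (a - \int[mu]_x (\1_(E l) x * w (iter k T x))).
    rewrite sumrB sumr_const card_ord mulrBr -[a *+ n]mulr_natl mulKf ?lt0r_neq0//.
    congr (_ - _); rewrite /b -Rint_sum; last by move=> k; exact: bmfM.
    rewrite -RintZ; last by apply: bmf_sum => k; exact: bmfM.
    by apply: eq_Rintegral => x _; rewrite /bsum mulrCA mulr_sumr.
  rewrite normrM gtr0_norm ?invr_gt0// ler_pdivrMl//.
  apply: (@le_trans _ _ (\sum_(k < n) (n%:R * (C * pr mu (A l))))).
    apply: (le_trans (ler_norm_sum _ _ _)); apply: ler_sum => k _.
    apply: (le_trans (shift_density w C (A l) (E l) k mw wC (mA l) mEl (EA l))).
    by rewrite ler_wpM2r ?mulr_ge0 ?pr_ge0// ler_nat ltnW.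
  rewrite sumr_const card_ord -[leLHS]mulr_natl ler_pM2l//.
  by have := pr_ge0 mu (A l); move: hl; rewrite /M; nra.
have bm : `|b - m * pr mu (E l)| <= e / 8.
  rewrite -Rint_indic// -RintZ// -RintB; [|exact: bmfM|by apply: bmfM => //; exact: bmf_cst].
  apply: le_trans hn; apply: (le_trans (Rint_norm _ _ _)).
    by apply: bmfB; apply: bmfM => //; exact: bmf_cst.
  apply: le_Rint.
  - by apply: bmf_norm; apply: bmfB; apply: bmfM => //; exact: bmf_cst.
  - by apply: bmf_norm; apply: bmfB => //; exact: bmf_cst.
  move=> x; rewrite mulrC -mulrBl normrM -[leRHS]mulr1 ler_wpM2l//.
  by rewrite ger0_norm ?indic_ge0 ?indic_le1.
have p0 := pr_ge0 mu (E l); have p1 := pr_le1 mu _ mEl.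
move: ab bm; rewrite !ler_norml => /andP[ab1 ab2] /andP[bm1 bm2].
by apply/andP; split; nra.
Qed.

End asymptotic_invariance.

(** * Measures in [Probs] and uniformity over compact sets of them *)

Section Probs_measure.
Context {R : realType} {d : measure_display} {X : measurableType d}
  (mu : set X -> \bar R) (nu : set X -> \bar R).
Hypothesis Pnu : Probs mu nu.

(* A [measure] must be nonnegative on all sets, [Probs] only constrains the
   measurable ones. *)
Definition measure_of_Probs (_ : Probs mu nu) (B : set X) : \bar R :=
  if `[< measurable B >] then nu B else 0%E.

Let m := measure_of_Probs Pnu.

Let mE B : measurable B -> m B = nu B.
Proof. by move=> mB; rewrite /m /measure_of_Probs asboolT. Qed.

Let m0 : m set0 = 0%E. Proof. by rewrite mE//; case: Pnu. Qed.

Let m_ge0 B : (0 <= m B)%E.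
Proof.
by rewrite /m /measure_of_Probs; case: ifPn => // /asboolP mB; case: Pnu => _ /(_ _ mB).
Qed.

Let m_sigma : semi_sigma_additive m.
Proof.
move=> F mF tF mU; rewrite mE//; case: Pnu => _ _ /(_ F mF tF mU) + _ _.
by under eq_fun do under eq_bigr do rewrite -mE//.
Qed.

HB.instance Definition _ := isMeasure.Build _ _ _ (measure_of_Probs Pnu) m0 m_ge0 m_sigma.

Let mT : measure_of_Probs Pnu setT = 1%E.
Proof. by rewrite -[LHS]/(m setT) mE//; case: Pnu. Qed.

HB.instance Definition _ := Measure_isProbability.Build _ _ _ (measure_of_Probs Pnu) mT.

Lemma ProbsP : exists p : probability X R,
  (forall B, measurable B -> nu B = p B) /\
  (forall B, measurable B -> mu B = 0%E -> p B = 0%E).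
Proof.
exists (measure_of_Probs Pnu); split => B mB; first by rewrite -mE.
by move=> B0; rewrite -[LHS]/(m B) mE//; case: Pnu => _ _ _ _; exact.
Qed.

End Probs_measure.

Lemma near_finite {I : choiceType} (J : set I) (Q : I -> nat -> Prop) :
  finite_set J -> (forall i, J i -> \forall l \near \oo, Q i l) ->
  \forall l \near \oo, forall i, J i -> Q i l.
Proof.
move=> /finite_seqP[s ->]; elim: s => [_|i s IH h].
  by apply: nearW => l i.
have [hi hs] : (\forall l \near \oo, Q i l) /\
    \forall l \near \oo, forall j, [set` s] j -> Q j l.
  split; first by apply: h; rewrite /= mem_head.
  by apply: IH => j js; apply: h; rewrite /= in_cons; apply/orP; right.
near=> l => j /=; rewrite in_cons => /predU1P[->|]; first by near: l.
by move: j; near: l.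
Unshelve. all: by end_near.
Qed.

Section compact_uniform.
Context {R : realType} {d : measure_display} {X : measurableType d}
  (mu : probability X R).
Implicit Types p q r : set X -> \bar R.

Lemma Probs_prE p B : Probs mu p -> measurable B -> p B = (pr p B)%:E.
Proof.
move=> /ProbsP[m [mp _]] mB; rewrite /pr fineK// mp//; exact: fin_num_measure.
Qed.

Lemma dP_ge0 p q : (0 <= dP p q)%E.
Proof.
rewrite mule_ge0//; apply: (@le_trans _ _ `|p set0 - q set0|%E); first exact: abse_ge0.
by apply: ereal_sup_ubound; exists set0.
Qed.

Lemma dP_bound p q B : Probs mu p -> Probs mu q -> measurable B ->
  ((2 * `|pr p B - pr q B|)%:E <= dP p q)%E.
Proof.
move=> Pp Pq mB; rewrite EFinM lee_pmul2l//; apply: ereal_sup_ubound; exists B => //.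
by rewrite (Probs_prE p)// (Probs_prE q).
Qed.

Lemma dP_triangle p q r : Probs mu p -> Probs mu q -> Probs mu r ->
  (dP p r <= dP p q + dP q r)%E.
Proof.
move=> Pp Pq Pr; rewrite {1}/dP muleC -lee_pdivlMr//; apply: ge_ereal_sup.
move=> _ [B mB <-]; rewrite lee_pdivlMr// muleC.
apply: (@le_trans _ _ ((2 * `|pr p B - pr q B|)%:E + (2 * `|pr q B - pr r B|)%:E)%E).
  rewrite (Probs_prE p)// (Probs_prE r)// -EFinB abse_EFin -EFinM -EFinD lee_fin.
  rewrite -mulrDr ler_pM2l//.
  have -> : pr p B - pr r B = (pr p B - pr q B) + (pr q B - pr r B) by ring.
  exact: ler_normD.
by apply: leeD; exact: dP_bound.
Qed.

Lemma dPxx p : Probs mu p -> dP p p = 0%E.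
Proof.
move=> Pp; rewrite /dP (_ : [set _ | B in measurable] = [set 0%E]).
  by rewrite ereal_sup1 mule0.
apply/seteqP; split => [_ [B mB <-]/=|_ ->].
  by rewrite (Probs_prE p)// -EFinB subrr abse_EFin normr0.
by exists set0 => //; rewrite (Probs_prE p)// -EFinB subrr abse_EFin normr0.
Qed.

Lemma openP_ball p (e : R) : Probs mu p ->
  openP mu [set q | Probs mu q /\ (dP p q < e%:E)%E].
Proof.
move=> Pp; split => [q []//|q [Pq pq]].
have fpq : dP p q \is a fin_num.
  by rewrite ge0_fin_numE ?dP_ge0// (lt_trans pq) ?ltry.
exists (e - fine (dP p q)); first by rewrite subr_gt0 -lte_fin fineK.
move=> r Pr qr; split => //; apply: (le_lt_trans (dP_triangle p q r Pp Pq Pr)).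
by rewrite addeC -lteBrDr// -{1}(fineK fpq) -EFinB.
Qed.

(** Evaluation at [E l] is Lipschitz for [dP] with a constant independent of l, so finitely many
    balls reduce the claim to their centres. The factor 2 in [dP] turns the radius e into an error
    below e/2. *)
Lemma compactP_uniform (K : set (set X -> \bar R)) (E : nat -> set X) :
  compactP mu K -> (forall l, measurable (E l)) ->
  (forall (p : probability X R) (e : R), p `<< mu -> 0 < e ->
    \forall l \near \oo, `|pr p (E l) - pr mu (E l)| <= e) ->
  forall e : R, 0 < e ->
  \forall l \near \oo, forall nu, K nu -> `|pr nu (E l) - pr mu (E l)| <= e.
Proof.
move=> [KP cK] mE hE e e0.
(* [U p] is empty unless p is in [Probs], so the index may range over all set functions. *)
pose U (p : set X -> \bar R) : set (set X -> \bar R) :=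
  [set q | Probs mu p /\ (Probs mu q /\ (dP p q < e%:E)%E)].
have oU p : openP mu (U p).
  split=> [q [_ []]//|q [Pp Uq]].
  have [_ /(_ q Uq)[e' e'0 h]] := openP_ball p e Pp.
  by exists e' => // r Pr /(h _ Pr).
have KU : K `<=` \bigcup_p U p.
  move=> q Kq; have Pq := KP _ Kq; exists q => //; split => //; split => //.
  by rewrite dPxx// lte_fin.
have [J fJ KJ] := cK _ U oU KU.
have : \forall l \near \oo, forall p, J p -> Probs mu p ->
    `|pr p (E l) - pr mu (E l)| <= e / 2.
  apply: (near_finite J (fun p l => Probs mu p -> _)) => // p Jp.
  have [Pp|nPp] := pselect (Probs mu p); last by apply: nearW => l.
  have [m [mp mac]] := ProbsP _ _ Pp.
  have mmu : m `<< mu by apply/null_content_dominatesP => B mB; exact: mac.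
  have e2 : 0 < e / 2 by lra.
  by apply: filterS (hE m (e / 2) mmu e2) => l hl _; rewrite /pr mp.
apply: filterS => l hl nu Knu.
have [p Jp [Pp [Pnu pnu]]] := KJ _ Knu.
have h1 := hl p Jp Pp.
have : ((2 * `|pr p (E l) - pr nu (E l)|)%:E < e%:E)%E.
  exact: le_lt_trans (dP_bound p nu _ Pp Pnu (mE l)) pnu.
rewrite lte_fin => h2.
have -> : pr nu (E l) - pr mu (E l) =
  (pr p (E l) - pr mu (E l)) - (pr p (E l) - pr nu (E l)) by ring.
apply: (le_trans (ler_normB _ _)); lra.
Qed.

End compact_uniform.

(** * The induced map *)

Section induced.
Context {R : realType} {d : measure_display} {X : measurableType d} (T : X -> X)
  (A : set X).

(** The return is required explicitly: without one [ret_time] is 0 and [induced_map] fixes x, so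
    membership of the image in E would not describe a return. *)
Definition hit_in (E : set X) : set X :=
  [set x | (exists n, (0 < n)%N && `[< A (iter n T x) >]) /\
           E (induced_map T A x)].

(** A T-invariant set on which every iterate of the induced map is a true return, so that the
    default value of [ret_time] never enters. *)
Definition visits_io : set X :=
  [set x | forall k : nat, exists n : nat, (k <= n)%N /\ A (iter n T x)].

Lemma ret_time_eq x n : (0 < n)%N -> A (iter n T x) ->
  (forall k, (0 < k < n)%N -> ~ A (iter k T x)) -> ret_time T A x = n.
Proof.
move=> n0 An kn; rewrite /ret_time; case: pselect => [h|[]]; last first.
  by exists n; rewrite n0; apply/asboolP.
case: ex_minnP => m /andP[m0 /asboolP Am] mmin.
have : (m <= n)%N by apply: mmin; rewrite n0; exact/asboolP.
rewrite leq_eqVlt => /orP[/eqP//|mn].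
by case: (kn m); rewrite ?m0.
Qed.

Lemma ret_timeP x : (exists n, (0 < n)%N && `[< A (iter n T x) >]) ->
  [/\ (0 < ret_time T A x)%N, A (induced_map T A x) &
      forall k, (0 < k < ret_time T A x)%N -> ~ A (iter k T x)].
Proof.
rewrite /induced_map /ret_time; case: pselect => // h _.
case: ex_minnP => m /andP[m0 /asboolP Am] mmin; split => // k /andP[k0 km] Ak.
have : (m <= k)%N by apply: mmin; rewrite k0; exact/asboolP.
by rewrite leqNgt km.
Qed.

Lemma induced_map_in x : A (T x) -> induced_map T A x = T x.
Proof.
by move=> ATx; rewrite /induced_map (ret_time_eq x 1)// => k; lia.
Qed.

Lemma induced_map_out x : ~ A (T x) ->
  (exists n, (0 < n)%N && `[< A (iter n T (T x)) >]) ->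
  induced_map T A x = induced_map T A (T x).
Proof.
move=> ATx /ret_timeP[n0 An kn].
rewrite /induced_map (ret_time_eq x (ret_time T A (T x)).+1) ?iterSr//.
case=> [//|[|k]] /andP[_ kr]; first by [].
by rewrite iterSr; apply: kn; move: kr; rewrite ltnS.
Qed.

(** This splitting at the first step yields the near invariance of [hit_in E] and, in [pr_induced],
    the invariance of mu_A under the induced map. *)
Lemma hit_inE E x : hit_in E x <-> (A (T x) /\ E (T x)) \/ (~ A (T x) /\ hit_in E (T x)).
Proof.
split=> [[[n /andP[n0 /asboolP An]] Ex]|].
  have [ATx|ATx] := pselect (A (T x)).
    by left; split => //; rewrite -induced_map_in.
  right; split => //.
  have h : exists n, (0 < n)%N && `[< A (iter n T (T x)) >].
    case: n n0 An => // -[|n] _; first by move=> /= /ATx.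
    by rewrite iterSr => An; exists n.+1; apply/asboolP.
  by split => //; rewrite -induced_map_out.
move=> [[ATx ETx]|[ATx [[n /andP[n0 /asboolP An]] ETx]]].
  by split; [exists 1%N; apply/asboolP|rewrite induced_map_in].
split; first by exists n.+1; apply/asboolP; rewrite iterSr.
by rewrite induced_map_out//; exists n; rewrite n0; apply/asboolP.
Qed.

Lemma hit_in_shift E x : ~ A (T x) -> hit_in E x <-> hit_in E (T x).
Proof. by move=> ATx; rewrite hit_inE; split => [[[]|[]]|] //; right. Qed.

Lemma hit_in_before E x t : (forall n, (0 < n <= t)%N -> ~ A (iter n T x)) ->
  hit_in E x <-> hit_in E (iter t T x).
Proof.
elim: t => [//|t IH] h; rewrite iterS -hit_in_shift; last first.
  by rewrite -iterS; apply: h; rewrite ltnSn.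
by apply: IH => n /andP[n0 nt]; apply: h; rewrite n0 ltnW.
Qed.

Hypothesis mT : measurable_fun setT T.
Hypothesis mA : measurable A.

Lemma measurable_hit_in E : measurable E -> measurable (hit_in E).
Proof.
move=> mE.
have -> : hit_in E = \bigcup_n ((iter n.+1 T @^-1` (A `&` E)) `&`
    \bigcap_(k in [set k | (0 < k < n.+1)%N]) ~` (iter k T @^-1` A)).
  apply/seteqP; split=> x.
    move=> [/ret_timeP[n0 An kn] Ex]; exists (ret_time T A x).-1 => //.
    by rewrite prednK.
  move=> [n _ [[An En] kn]]; have h : ret_time T A x = n.+1.
    by apply: ret_time_eq => // k; exact: kn.
  split; first by exists n.+1; apply/asboolP.
  by rewrite /induced_map h.
apply: bigcup_measurable => n _; apply: measurableI.
  by apply: measurable_preiter => //; exact: measurableI.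
rewrite -[X in measurable X]setCK; apply: measurableC; rewrite setC_bigcap.
by apply: bigcup_measurable => k _; rewrite setCK; exact: measurable_preiter.
Qed.

Lemma measurable_visits_io : measurable visits_io.
Proof.
have -> : visits_io = \bigcap_k \bigcup_(n in [set n | (k <= n)%N]) (iter n T @^-1` A).
  apply/seteqP; split=> x /= h k => [_|]; first by have [n []] := h k; exists n.
  by have [n kn An] := h k Logic.I; exists n.
apply: bigcapT_measurable => k; apply: bigcup_measurable => n _.
exact: measurable_preiter.
Qed.

Lemma visits_io_invariant : T @^-1` visits_io = visits_io.
Proof.
apply/seteqP; split=> x h k.
  by have [n [kn An]] := h k; exists n.+1; split; [exact: leqW|rewrite iterSr].
have [n [kn An]] := h k.+1; case: n kn An => // n kn An.
by exists n; split => //; rewrite -iterSr.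
Qed.

Lemma visits_io_iter n x : visits_io x -> visits_io (iter n T x).
Proof.
elim: n x => [//|n IH] x Vx; rewrite iterSr; apply: IH.
by rewrite -[visits_io _]/((T @^-1` visits_io) x) visits_io_invariant.
Qed.

Lemma visits_io_returns x : visits_io x ->
  exists n, (0 < n)%N && `[< A (iter n T x) >].
Proof. by move=> /(_ 1%N)[n [n0 An]]; exists n; rewrite n0; apply/asboolP. Qed.

Lemma visits_io_induced x : visits_io x -> visits_io (induced_map T A x).
Proof. exact: visits_io_iter. Qed.

Lemma hit_in_visits E x : visits_io x -> hit_in E x <-> E (induced_map T A x).
Proof. by move=> /visits_io_returns h; split => [[]|]. Qed.

Context (mu : probability X R).
Hypothesis mpT : measure_preserving mu T.

(* hit_in E = T^-1 ((hit_in E \ A) U E), so the masses of hit_in E \ A cancel. *)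
Lemma pr_induced E : measurable E -> E `<=` A -> pr mu (A `&` hit_in E) = pr mu E.
Proof.
move=> mE EA; have mH := measurable_hit_in E mE.
have mAC : measurable (~` A) by exact: measurableC.
have HE : hit_in E = T @^-1` ((hit_in E `&` ~` A) `|` E).
  apply/seteqP; split=> x; first by move=> /hit_inE[[]|[]]; [right|left].
  by move=> h; apply/hit_inE; case: h => [[]|Ex]; [right|left; split => //; exact: EA].
have mHA : measurable (hit_in E `&` ~` A) by exact: measurableI.
have h1 : pr mu (hit_in E) = pr mu (hit_in E `&` ~` A) + pr mu E.
  rewrite {1}HE (pr_preT _ _ mpT); last exact: measurableU.
  rewrite pr_setU//; apply/seteqP; split => // x [[_ nA] /EA]; exact: nA.
have h2 := pr_split mu _ _ mH mA.
by rewrite setIC; lra.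
Qed.

Hypothesis ergT : ergodic mu T.

(** By ergodicity only a positive mass is required. The preimages [V k] of the points that ever
    visit A decrease to [visits_io], and all have the same mass, which is at least mu(A). *)
Lemma pr_visits_io : 0 < pr mu A -> pr mu visits_io = 1.
Proof.
move=> A0.
have [|//] := pr_invariant mu T ergT _ measurable_visits_io visits_io_invariant.
pose U := \bigcup_n (iter n T @^-1` A).
have mU : measurable U by apply: bigcupT_measurable => n; exact: measurable_preiter.
have AU : pr mu A <= pr mu U by apply: le_pr => // x Ax; exists 0%N.
pose V k := iter k T @^-1` U.
have mV k : measurable (V k) by exact: measurable_preiter.
have IV : visits_io = \bigcap_k V k.
  apply/seteqP; split=> x h k => [_|].
    have [n [kn An]] := h k; exists (n - k)%N => //.
    by rewrite /preimage/= -iterD subnK.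
  have [n _ An] := h k Logic.I; exists (n + k)%N; split; first exact: leq_addl.
  by rewrite iterD.
have niV : nonincreasing_seq V.
  apply/nonincreasing_seqP => n; apply/subsetPset => x [k _ Ak].
  by exists k.+1 => //; rewrite /preimage /mkset iterSr; exact: Ak.
have : pr mu (V k) @[k --> \oo] --> pr mu visits_io.
  by rewrite IV; exact: pr_nonincreasing_cvg.
have -> : (fun k => pr mu (V k)) = fun=> pr mu U.
  by apply/funext => k; exact: (pr_preiter _ _ mpT).
move=> /cvg_lim <-//; rewrite lim_cst// => h; lra.
Qed.

End induced.

(** * L^2 density and continuity sets *)

Inductive lspan {R : realType} {Y : Type} (G : set (set Y)) : (Y -> R) -> Prop :=
| lspan_indic B : G B -> lspan G \1_B
| lspan_lin a b f g : lspan G f -> lspan G g ->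
    lspan G (fun x => a * f x + b * g x).

Section lspan.
Context {R : realType} {Y : Type} (G : set (set Y)).
Implicit Types f g : Y -> R.

Lemma lspanZ a f : lspan G f -> lspan G (fun x => a * f x).
Proof.
move=> Gf; rewrite (_ : (fun x => _) = (fun x => a * f x + 0 * f x)).
  exact: lspan_lin.
by apply/funext => x; ring.
Qed.

Lemma lspanD f g : lspan G f -> lspan G g -> lspan G (fun x => f x + g x).
Proof.
move=> Gf Gg; rewrite (_ : (fun x => _) = (fun x => 1 * f x + 1 * g x)).
  exact: lspan_lin.
by apply/funext => x; ring.
Qed.

Lemma lspanB f g : lspan G f -> lspan G g -> lspan G (fun x => f x - g x).
Proof.
move=> Gf Gg; rewrite (_ : (fun x => _) = (fun x => 1 * f x + (-1) * g x)).
  exact: lspan_lin.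
by apply/funext => x; ring.
Qed.

Lemma lspan_cst (c : R) : G setT -> lspan G (fun=> c).
Proof.
move=> GT; rewrite (_ : (fun=> c) = (fun x => c * \1_setT x)).
  by apply: lspanZ; exact: lspan_indic.
by apply/funext => x; rewrite indicT mulr1.
Qed.

Lemma lspanM f g : setI_closed G -> lspan G f -> lspan G g ->
  lspan G (fun x => f x * g x).
Proof.
move=> GI; elim=> [B GB|a b f1 f2 _ IH1 _ IH2] Gg.
  elim: Gg => [C GC|a b f1 f2 _ IH1 _ IH2].
    rewrite (_ : (fun x => _) = \1_(B `&` C)); first by apply: lspan_indic; exact: GI.
    by rewrite indicI.
  rewrite (_ : (fun x => _) = (fun x => a * (\1_B x * f1 x) + b * (\1_B x * f2 x))).
    exact: lspan_lin.
  by apply/funext => x; ring.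
rewrite (_ : (fun x => _) = (fun x => a * (f1 x * g x) + b * (f2 x * g x))).
  by apply: lspan_lin; [exact: IH1|exact: IH2].
by apply/funext => x; ring.
Qed.

Lemma lspanS (H : set (set Y)) f : G `<=` H -> lspan G f -> lspan H f.
Proof.
move=> GH; elim=> [B GB|a b f1 f2 _ IH1 _ IH2]; last exact: lspan_lin.
by apply: lspan_indic; exact: GH.
Qed.

(** Linearity is asked only on the span because the functionals in question are additive only on
    bounded measurable functions. *)
Lemma lspan_cvg (Lam : nat -> (Y -> R) -> R) f :
  (forall l a b g h, lspan G g -> lspan G h ->
    Lam l (fun x => a * g x + b * h x) = a * Lam l g + b * Lam l h) ->
  (forall B, G B -> Lam l \1_B @[l --> \oo] --> (0 : R)) ->
  lspan G f -> Lam l f @[l --> \oo] --> (0 : R).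
Proof.
move=> lin h; elim=> [B /h//|a b f1 f2 G1 IH1 G2 IH2].
rewrite (_ : (fun l => _) = (fun l => a * Lam l f1 + b * Lam l f2)); last first.
  by apply/funext => l; rewrite lin.
have : a * Lam l f1 + b * Lam l f2 @[l --> \oo] --> a * 0 + b * 0.
  by apply: cvgD; apply: cvgM => //; exact: cvg_cst.
by rewrite !mulr0 addr0.
Qed.

End lspan.

Section lspan_dense.
Context {R : realType} {d : measure_display} {Y : measurableType d}
  (M : probability Y R) (G : set (set Y)).
Hypothesis GE : @measurable _ Y = <<s G >>.
Hypothesis GI : setI_closed G.
Hypothesis GT : G setT.

Lemma measurable_gen B : G B -> measurable B.
Proof. by move=> GB; rewrite GE; exact: sub_gen_smallest. Qed.

Lemma lspan_bmf f : lspan G f -> bmf (f : Y -> R).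
Proof.
elim=> [B GB|a b f1 f2 _ IH1 _ IH2]; first exact/bmf_indic/measurable_gen.
by apply: bmfD; apply: bmfM => //; exact: bmf_cst.
Qed.

(** L^2 approximability is a Dynkin property: 1 - g serves the complement, and a disjoint union is
    approximated by a finite part of it, up to a small mass. *)
Lemma lspan_dense C (e : R) : measurable C -> 0 < e ->
  exists2 g : Y -> R, lspan G g & \int[M]_x ((\1_C x - g x) ^+ 2) <= e.
Proof.
have bsq (D : set Y) g : measurable D -> bmf g -> bmf (fun x => (\1_D x - g x) ^+ 2 : R).
  move=> mD bg; under eq_fun do rewrite expr2.
  by apply: bmfM; apply: bmfB => //; exact: bmf_indic.
move=> mC; move: mC e; rewrite GE; move: C.
apply: dynkin_induction => //.
- move=> e e0; exists \1_setT; first exact: lspan_indic.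
  under eq_Rintegral do rewrite subrr expr0n/=.
  by rewrite Rint_cst ltW.
- move=> B GB e e0; exists \1_B; first exact: lspan_indic.
  under eq_Rintegral do rewrite subrr expr0n/=.
  by rewrite Rint_cst ltW.
- move=> B mB IH e /IH[g Gg gB]; exists (fun x => 1 - g x).
    by apply: lspanB => //; exact: lspan_cst.
  apply: le_trans gB; rewrite le_eqVlt; apply/orP; left; apply/eqP.
  apply: eq_Rintegral => x _; have [Bx|Bx] := pselect (B x).
    by rewrite [\1_B x]indic1// indic0N; [ring|apply].
  by rewrite [\1_B x]indic0N// indic1//; ring.
- move=> B mB tB IH e e0.
  pose U n := \bigcup_(k in `I_n) B k.
  have mU n : measurable (U n) by apply: bigcup_measurable.
  have approxU n : forall e : R, 0 < e -> exists2 g : Y -> R, lspan G g &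
      \int[M]_x ((\1_(U n) x - g x) ^+ 2) <= e.
    elim: n => [|n IHn] e' e'0.
      exists (fun=> 0); first exact: lspan_cst.
      have -> : \int[M]_x ((\1_(U 0%N) x - 0) ^+ 2) = \int[M]_x (0 : R).
        by apply: eq_Rintegral => x _; rewrite indic0N ?subrr ?expr0n// => -[k].
      by rewrite Rint_cst ltW.
    (* The square of a sum is at most twice the sum of the squares, so each of the two errors is
       allowed a quarter. *)
    have e4 : 0 < e' / 4 by lra.
    have [g Gg hg] := IHn _ e4; have [h Gh hh] := IH n _ e4.
    exists (fun x => g x + h x); first exact: lspanD.
    have bg := lspan_bmf _ Gg; have bh := lspan_bmf _ Gh.
    apply: (@le_trans _ _ (\int[M]_x (2 * (\1_(U n) x - g x) ^+ 2 +
                                     2 * (\1_(B n) x - h x) ^+ 2))).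
      apply: le_Rint; [apply: bsq => //; exact: bmfD| |].
        by apply: bmfD; apply: bmfM; (exact: bmf_cst || exact: bsq).
      move=> x; have -> : \1_(U n.+1) x = \1_(U n) x + \1_(B n) x :> R.
        have [Bx|Bx] := pselect (B n x).
          rewrite [X in _ + X]indic1// [X in X + _]indic0N ?add0r ?indic1//.
            by exists n => /=.
          move=> [k /= kn Bk]; have := tB k n Logic.I Logic.I.
          by move=> /(_ (ex_intro _ x (conj Bk Bx))) kE; rewrite kE ltnn in kn.
        rewrite [X in _ + X]indic0N// addr0.
        have [Ux|Ux] := pselect (U n x).
          by rewrite !indic1//; case: Ux => k /= kn Bk; exists k => //=; lia.
        rewrite !indic0N// => -[k /=]; rewrite ltnS leq_eqVlt => /orP[/eqP->//|kn Bk].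
        by apply: Ux; exists k.
      set p := \1_(U n) x; set q := \1_(B n) x.
      rewrite -subr_ge0 (_ : _ - _ = ((p - g x) - (q - h x)) ^+ 2) ?sqr_ge0//; ring.
    rewrite RintD; [|by apply: bmfM; [exact: bmf_cst|exact: bsq]..].
    rewrite !RintZ; [|exact: bsq..].
    lra.
  have UB : \bigcup_n U n = \bigcup_k B k.
    apply/seteqP; split=> x; first by move=> [n _ [k _ Bk]]; exists k.
    by move=> [k _ Bk]; exists k.+1 => //; exists k => /=.
  have ndU : nondecreasing_seq U.
    by apply/nondecreasing_seqP => n; apply/subsetPset => x [k /= kn Bk]; exists k => //=; lia.
  have mUU : measurable (\bigcup_n U n) by exact: bigcup_measurable.
  have e4 : 0 < e / 4 by lra.
  have := pr_nondecreasing_cvg M U mU ndU; move=> /cvgrPdist_lt/(_ _ e4)[n _ /(_ n (leqnn n))]/=.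
  move=> hn; have [g Gg hg] := approxU n _ e4; exists g => //.
  have bg := lspan_bmf _ Gg.
  rewrite -UB; set V := \bigcup_n U n in mUU hn *.
  have UV : U n `<=` V by move=> x Ux; exists n.
  have mVU : measurable (V `&` ~` U n) by apply: measurableI => //; exact: measurableC.
  apply: (@le_trans _ _ (\int[M]_x (2 * \1_(V `&` ~` U n) x + 2 * (\1_(U n) x - g x) ^+ 2))).
    apply: le_Rint; first exact: bsq.
      by apply: bmfD; apply: bmfM; (exact: bmf_cst || exact: bsq || exact: bmf_indic).
    move=> x; have -> : \1_V x = \1_(V `&` ~` U n) x + \1_(U n) x :> R.
      have [Ux|Ux] := pselect (U n x).
        by rewrite [\1_(U n) x]indic1// indic1 ?indic0N ?add0r//; [case|exact: UV].
      rewrite [\1_(U n) x]indic0N// addr0.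
      by have [Vx|Vx] := pselect (V x); [rewrite !indic1|rewrite !indic0N// => -[]].
    set p := \1_(U n) x.
    set q := \1_(V `&` ~` U n) x.
    (* An indicator equals its square, so the missing mass is itself a squared L^2 error. *)
    have q2 : q ^+ 2 = q by rewrite /q indicE; case: (_ \in _); rewrite ?expr1n ?expr0n.
    rewrite -[X in _ <= 2 * X + _]q2.
    rewrite -subr_ge0 (_ : _ - _ = (q - (p - g x)) ^+ 2) ?sqr_ge0//; ring.
  rewrite RintD; [|by apply: bmfM; (exact: bmf_cst || exact: bsq || exact: bmf_indic)..].
  rewrite !RintZ; [|exact: bsq|exact: bmf_indic].
  rewrite Rint_indic//.
  have := pr_split M V (U n) mUU (mU n); rewrite (setIidr UV) => hs.
  move: hn; rewrite ltr_norml => /andP[_ hn]; lra.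
Qed.

End lspan_dense.

(** * Weak convergence and continuity sets *)

Section portmanteau.
Context {R : realType} {F : pseudoPMetricType R}.
Hypothesis hF : hausdorff_space F.
Hypothesis cF : compact [set: F].

Lemma measurable_open (U : set F) : open U -> measurable (U : set (borelT F)).
Proof. by move=> oU; exact: sub_gen_smallest. Qed.

Lemma measurable_closed (U : set F) : closed U -> measurable (U : set (borelT F)).
Proof.
move=> cU; rewrite -[U]setCK; apply: measurableC; apply: measurable_open.
by rewrite openC.
Qed.

Lemma continuous_bmf (f : F -> R) : continuous f -> bounded_fun f ->
  bmf (f : borelT F -> R).
Proof.
move=> cf [B [_ hB]]; split; last by exists (B + 1) => x; apply: hB => //; rewrite ltrDl.
apply: (measurability _ (RGenOpens.measurableE R)) => _ [_ [a [b ->]] <-].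
rewrite setTI; apply: measurable_open.
by move/continuousP : cf; apply; exact: interval_open.
Qed.

Lemma boundaryC (B : set F) : boundary (~` B) = boundary B.
Proof.
by rewrite /boundary closure_setC interiorC !setDE setCK setIC.
Qed.

Lemma boundaryI (B C : set F) : boundary (B `&` C) `<=` boundary B `|` boundary C.
Proof.
move=> x [cl it]; have clB : closure B x by apply: closureS cl; exact: subIsetl.
have clC : closure C x by apply: closureS cl; exact: subIsetr.
have [iB|] := pselect (interior B x); last by left.
by have [iC|] := pselect (interior C x); [case: it; rewrite interiorI|right].
Qed.

Lemma measurable_boundary (B : set F) : measurable (boundary B : set (borelT F)).
Proof.
apply: measurableD; [apply: measurable_closed; exact: closed_closure|].
by apply: measurable_open; exact: open_interior.
Qed.

Context (M : probability (borelT F) R).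

Definition contset : set (set F) :=
  [set B | measurable (B : set (borelT F)) /\ pr M (boundary B) = 0].

Lemma contsetI : setI_closed contset.
Proof.
move=> B C [mB B0] [mC C0]; split; first exact: measurableI.
apply: (pr_eq0 M (boundary (B `&` C)) (boundary B `|` boundary C)).
- exact: measurable_boundary.
- by apply: measurableU; exact: measurable_boundary.
- exact: boundaryI.
apply/eqP; rewrite eq_le pr_ge0 andbT.
rewrite (le_trans (pr_setU_le _ _ _ _ _)) ?B0 ?C0 ?addr0//; exact: measurable_boundary.
Qed.

Lemma contsetT : contset setT.
Proof.
split; first exact: measurableT.
by rewrite /boundary closureT interiorT setDv pr_set0.
Qed.

(** The 1/(n+1)-neighbourhoods of a closed set decrease to it. Interiors are taken because a [ball]
    need not be open. *)
Lemma closed_outer (K : set F) (e : R) : closed K -> 0 < e ->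
  exists U : set F, [/\ open U, K `<=` U & pr M U <= pr M K + e].
Proof.
move=> cK e0; pose U (n : nat) := \bigcup_(x in K) (ball x (n.+1%:R^-1 : R))°.
have oU n : open (U n) by apply: bigcup_open => x _; exact: open_interior.
have KU n : K `<=` U n.
  by move=> x Kx; exists x => //; apply: nbhsx_ballx; rewrite invr_gt0.
have niU : nonincreasing_seq U.
  apply/nonincreasing_seqP => n; apply/subsetPset => x [y Ky yx]; exists y => //.
  apply: interiorS yx => z; apply: le_ball.
  by rewrite lef_pV2 ?posrE// ler_nat.
have IU : \bigcap_n U n = K.
  apply/seteqP; split=> y; last by move=> Ky n _; exact: KU.
  move=> h; rewrite (closure_id K).1// => B /nbhs_ballP[r /= r0 rB].
  have [n rn] := ex_nat_gt r^-1.
  have [x Kx /interior_subset xy] := h n Logic.I.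
  exists x; split => //; apply: rB; apply: ball_sym; apply: le_ball xy.
  by rewrite -[r]invrK lef_pV2 ?posrE ?invr_gt0// (le_trans (ltW rn))// ler_nat.
have mU n : measurable (U n : set (borelT F)) by exact: measurable_open.
have := pr_nonincreasing_cvg M U mU niU; rewrite IU => /cvgrPdist_lt/(_ _ e0).
move=> [n _ /(_ n (leqnn n))]/=; rewrite ltr_norml => /andP[h _].
by exists (U n); split => //; lra.
Qed.

Lemma closed_upper_fun (K : set F) (e : R) : closed K -> 0 < e ->
  exists f : F -> R, [/\ continuous f, (forall x, 0 <= f x <= 1),
    (forall x, K x -> f x = 1) & \int[M]_x f x <= pr M K + e].
Proof.
move=> cK e0; have [U [oU KU MU]] := closed_outer K e cK e0.
have sep : uniform_separator K (~` U).
  apply: normal_uniform_separator => //; first exact: compact_normal.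
    by rewrite closedC.
  by apply/disjoints_subset; rewrite setCK.
pose f x : R := 1 - Urysohn K (~` U) x.
have cf : continuous f.
  by move=> x; apply: cvgB; [exact: cvg_cst|exact: Urysohn_continuous].
have f01 x : 0 <= f x <= 1.
  have := @Urysohn_range F R K (~` U) (Urysohn K (~` U) x) (ex_intro2 _ _ x Logic.I erefl).
  by rewrite /= in_itv/= /f => /andP[h1 h2]; apply/andP; split; lra.
have bf : bounded_fun f.
  exists 1; split; first exact: num_real.
  move=> z z1 x _ /=; have /andP[h0 h1] := f01 x.
  by rewrite ger0_norm// (le_trans h1)// ltW.
exists f; split => //.
  move=> x Kx; have := @Urysohn_sub0 F R _ _ sep _ (ex_intro2 _ _ x Kx erefl).
  by rewrite /f /= => ->; rewrite subr0.
apply: le_trans MU; have mU := measurable_open U oU.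
rewrite -Rint_indic//; apply: le_Rint; [exact: continuous_bmf|exact: bmf_indic|].
move=> x; have [Ux|Ux] := pselect (U x).
  by rewrite indic1//; have /andP[] := f01 x.
have := @Urysohn_sub1 F R _ _ sep _ (ex_intro2 _ _ x Ux erefl).
by rewrite /f /= => ->; rewrite subrr indic0N.
Qed.

Lemma contset_closure C : contset C -> pr M (closure C) = pr M C.
Proof.
move=> [mC bC]; have mcl : measurable (closure C : set (borelT F)).
  by apply: measurable_closed; exact: closed_closure.
apply/eqP; rewrite eq_le; apply/andP; split; last first.
  by apply: le_pr => //; exact: subset_closure.
rewrite -[leRHS]addr0 -bC.
have mb := measurable_boundary C.
apply: le_trans (pr_setU_le M C _ mC mb); apply: le_pr => //; first exact: measurableU.
move=> x cx; have [Cx|Cx] := pselect (C x); first by left.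
by right; split => // /interior_subset.
Qed.

(** [Lam l] stands for the expectation under the law of psi_(A_l). The indicator of C lies between 1
    - g and f, where f and g are continuous majorants of the closures of C and of its complement;
    for a continuity set both closures have the M-mass of the sets themselves. *)
Lemma portmanteau (Lam : nat -> (F -> R) -> R) :
  (forall l f g, bmf (f : borelT F -> R) -> bmf (g : borelT F -> R) ->
    (forall x, f x <= g x) -> Lam l f <= Lam l g) ->
  (forall f, continuous f -> bounded_fun f ->
    Lam l f @[l --> \oo] --> \int[M]_x f x) ->
  forall C, contset C -> Lam l \1_C @[l --> \oo] --> pr M C.
Proof.
move=> mono weak C cC; have [mC bC] := cC.
have cCC : contset (~` C) by split; [exact: measurableC|rewrite boundaryC].
have fin (f : F -> R) : (forall x, 0 <= f x <= 1) -> bounded_fun f.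
  move=> f01; exists 1; split; first exact: num_real.
  move=> z z1 x _ /=; have /andP[h0 h1] := f01 x.
  by rewrite ger0_norm// (le_trans h1)// ltW.
apply/cvgrPdist_lt => e e0; have e2 : 0 < e / 2 by lra.
have [f [cf f01 fC Mf]] := closed_upper_fun _ _ (@closed_closure _ C) e2.
have [g [cg g01 gC Mg]] := closed_upper_fun _ _ (@closed_closure _ (~` C)) e2.
rewrite contset_closure// in Mf; rewrite contset_closure// pr_setC// in Mg.
have bf := fin _ f01; have bg := fin _ g01.
have mf := continuous_bmf f cf bf; have mg := continuous_bmf g cg bg.
have cg1 : continuous (fun x => 1 - g x) by move=> x; apply: cvgB; [exact: cvg_cst|exact: cg].
have bg1 : bounded_fun (fun x => 1 - g x).
  by apply: fin => x; have /andP[h0 h1] := g01 x; apply/andP; split; lra.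
have mg1 := continuous_bmf _ cg1 bg1.
have Mg1 : \int[M]_x (1 - g x) = 1 - \int[M]_x g x.
  by rewrite RintB//; [rewrite Rint_cst|exact: bmf_cst].
have bC1 : bmf (\1_C : borelT F -> R) by exact: bmf_indic.
have h1 l : Lam l \1_C <= Lam l f.
  apply: mono => // x; have [Cx|Cx] := pselect (C x).
    by rewrite indic1// fC//; exact: subset_closure.
  by rewrite indic0N//; have /andP[] := f01 x.
have h2 l : Lam l (fun x => 1 - g x) <= Lam l \1_C.
  apply: mono => // x; have [Cx|Cx] := pselect (C x).
    by rewrite indic1//; have /andP[h0 ?] := g01 x; lra.
  by rewrite indic0N// gC ?subrr//; exact: subset_closure.
have /cvgrPdist_lt/(_ _ e2) H1 := weak f cf bf.
have /cvgrPdist_lt/(_ _ e2) H2 := weak _ cg1 bg1.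
near=> l.
have : `|\int[M]_x f x - Lam l f| < e / 2 by near: l.
have : `|\int[M]_x (1 - g x) - Lam l (fun x => 1 - g x)| < e / 2 by near: l.
rewrite !ltr_norml Mg1 => /andP[a1 a2] /andP[b1 b2].
by have := h1 l; have := h2 l => a3 b3; apply/andP; split; lra.
Unshelve. all: by end_near.
Qed.

End portmanteau.

(** * Rectangles in the sequence space *)

Section null_level.
Context {R : realType} {d : measure_display} {Y : measurableType d}
  (M : probability Y R) (u : Y -> R).
Hypothesis mu : measurable_fun setT u.

Let mlev (B : set R) : measurable B -> measurable (u @^-1` B).
Proof. by move=> mB; rewrite -[X in measurable X]setTI; exact: mu. Qed.

Lemma pr_levels (s : seq R) : uniq s ->
  measurable (u @^-1` [set` s]) /\
  pr M (u @^-1` [set` s]) = \sum_(r <- s) pr M (u @^-1` [set r]).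
Proof.
elim: s => [_|r s IH /= /andP[rs us]].
  by rewrite big_nil set_nil preimage_set0 pr_set0.
have [ms prs] := IH us.
have -> : u @^-1` [set` r :: s] = u @^-1` [set r] `|` u @^-1` [set` s].
  apply/seteqP; split=> x /=; rewrite in_cons.
    by move=> /predU1P[?|?]; [left|right].
  by move=> [->|->]; rewrite ?eqxx ?orbT.
have m1 : measurable (u @^-1` [set r]) by apply: mlev; exact: measurable_set1.
split; first exact: measurableU.
rewrite big_cons -prs pr_setU//.
by apply/seteqP; split=> // x [/= ->]; exact/negP.
Qed.

(** Distinct levels are disjoint events, so n + 1 of them with mass above 1/(n+1) would exceed the
    total mass 1. *)
Lemma finite_heavy_levels (n : nat) :
  finite_set [set r : R | n.+1%:R^-1 < pr M (u @^-1` [set r])].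
Proof.
apply: contrapT => /(infinite_set_fset n.+1)[B BD nB].
have [mB prB] := pr_levels _ (finmap.fset_uniq B).
have := pr_le1 M _ mB; rewrite prB; apply/negP; rewrite -ltNge.
move: nB BD; set s := finmap.enum_fset B => nB BD.
have {}BD r : r \in s -> n.+1%:R^-1 < pr M (u @^-1` [set r]) by move=> rs; exact: (BD r).
case: s nB BD {prB mB} => // r s nB BD.
rewrite big_cons; have hr : n.+1%:R^-1 < pr M (u @^-1` [set r]) by apply: BD; rewrite mem_head.
have hs : n%:R * (n.+1%:R^-1 : R) <= \sum_(r <- s) pr M (u @^-1` [set r]).
  apply: (@le_trans _ _ (\sum_(r <- s) (n.+1%:R^-1 : R))).
    rewrite big_const_seq count_predT iter_addr_0 -[leRHS]mulr_natl.
    by rewrite ler_wpM2r ?invr_ge0// ler_nat.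
  rewrite big_seq [leRHS]big_seq; apply: ler_sum => t ts; apply/ltW/BD.
  by rewrite /= in_cons ts orbT.
have : (n%:R + 1) * (n.+1%:R^-1 : R) = 1 by rewrite natr1 mulfV.
rewrite mulrDl mul1r; move: hr hs; set i := _^-1; set j := _ * i; lra.
Qed.

(** Only countably many levels carry mass, while the unit interval has positive Lebesgue measure. *)
Lemma null_level : exists2 r : R, 0 < r < 1 & pr M (u @^-1` [set r]) = 0.
Proof.
apply: contrapT => h.
have cov : `]0, 1[%classic `<=` \bigcup_n [set r : R | n.+1%:R^-1 < pr M (u @^-1` [set r])].
  move=> r /=; rewrite in_itv/= => r01.
  have pos : 0 < pr M (u @^-1` [set r]).
    rewrite lt_neqAle pr_ge0 andbT eq_sym; apply/eqP => r0; apply: h.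
    by exists r.
  have [n hn] := ex_nat_gt (pr M (u @^-1` [set r]))^-1.
  exists n => //=; rewrite -[ltRHS]invrK ltf_pV2 ?posrE ?invr_gt0//.
  by rewrite (lt_trans hn)// ltr_nat.
have cnt : countable (`]0, 1[%classic : set R).
  apply: sub_countable (subset_card_le cov) _; apply: bigcup_countable => // n _.
  by apply: finite_set_countable; exact: finite_heavy_levels.
have := countable_lebesgue_measure0 cnt.
rewrite lebesgue_measure_itv/= lte01 sube0 => /eqP.
by rewrite eqe oner_eq0.
Qed.

End null_level.

Section rectangles.
Context {R : realType} {F : pseudoPMetricType R} (M : probability (borelT F) R).

(** C is a sublevel set below r of a Urysohn function that is 0 at x and 1 off the interior of U.
    Its boundary lies in the level r, which is chosen M-null; r > 0 puts x in C, and r < 1 keeps C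
    inside U. *)
Lemma contset_nbhs (x : F) (U : set F) : nbhs x U ->
  exists C : set F, [/\ open C, contset M C, C x & C `<=` U].
Proof.
move=> Ux; have oU : open (interior U) by exact: open_interior.
have sep : uniform_separator [set x] (~` interior U).
  have cU : closed (~` interior U) by rewrite closedC.
  by apply: (@point_uniform_separator R F x _ cU); apply.
pose u := @Urysohn F R [set x] (~` interior U).
have cu : continuous u by exact: Urysohn_continuous.
have bu : bounded_fun u.
  exists 1; split; first exact: num_real.
  move=> z z1 y _ /=.
  have := @Urysohn_range F R [set x] (~` interior U) (u y) (ex_intro2 _ _ y Logic.I erefl).
  rewrite /= in_itv/= => /andP[h1 h2].
  by rewrite ger0_norm// (le_trans h2)// ltW.
have [mu _] := continuous_bmf u cu bu.
have [r /andP[r0 r1] Mr] := null_level M u mu.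
have oC : open [set y | u y < r].
  by have /continuousP/(_ _ (@open_lt _ r)) := cu.
exists [set y | u y < r]; split => //.
- split; first exact: measurable_open.
  apply: (pr_eq0 M _ (u @^-1` [set r])) => //; first exact: measurable_boundary.
    by rewrite -[X in measurable X]setTI; apply: mu => //; exact: measurable_set1.
  move=> y [cy iy]; apply/eqP; rewrite eq_le; apply/andP; split.
    have cl : closed [set y | u y <= r].
      by have /continuous_closedP/(_ _ (@closed_le _ r)) := cu.
    have : closure [set y | u y < r] `<=` [set y | u y <= r].
      by rewrite [X in _ `<=` X](closure_id _).1//; apply: closureS => z /= /ltW.
    by apply.
  by rewrite leNgt; apply/negP => h; apply: iy; exact: open_nbhs_nbhs.
- have := @Urysohn_sub0 F R _ _ sep _ (ex_intro2 _ _ x erefl erefl).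
  by rewrite /u /= => ->.
- move=> y /= uy; apply: interior_subset; apply: contrapT => Uy.
  have := @Urysohn_sub1 F R _ _ sep _ (ex_intro2 _ _ y Uy erefl).
  by rewrite -/u /= => h; move: uy; rewrite h; lra.
Qed.

Definition rect (n : nat) (B : nat -> set F) : set (nat -> F) :=
  [set y | forall j, (j <= n)%N -> B j (y j)].

Definition rects : set (set (nat -> F)) :=
  [set E | exists n B, (forall j, contset M (B j)) /\ E = rect n B].

Lemma rectsI : setI_closed rects.
Proof.
move=> _ _ [n [B [cB ->]]] [m [C [cC ->]]].
(* Coordinates beyond the end of the shorter rectangle are unconstrained there, hence the padding
   with [setT]. *)
exists (maxn n m), (fun j => (if (j <= n)%N then B j else setT) `&`
  (if (j <= m)%N then C j else setT)); split.
  by move=> j; apply: contsetI; case: ifP => // _; exact: contsetT.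
apply/seteqP; split=> y.
  by move=> [By Cy] j _; split; case: ifPn => // jn; [exact: By|exact: Cy].
move=> h; split=> j jn; have [] := h j; rewrite ?leq_max ?jn ?orbT//.
Qed.

Lemma rectsT : rects setT.
Proof.
by exists 0%N, (fun=> setT); split=> [j|]; [exact: contsetT|apply/seteqP].
Qed.

(** The sets containing a finite-dimensional box around y form a filter that converges to y in every
    coordinate, hence in the product topology; so W contains such a box, whose sides are then shrunk
    to open continuity sets. *)
Lemma rect_nbhs (y : {ptws nat -> F}) (W : set {ptws nat -> F}) : nbhs y W ->
  exists n B, [/\ forall j, contset M (B j), rect n B `<=` W & nbhs y (rect n B)].
Proof.
move=> yW.
pose Fil : set_system {ptws nat -> F} :=
  [set V | exists n B, (forall j, nbhs (y j) (B j)) /\ rect n B `<=` V].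
have FF : Filter Fil.
  split.
  - by exists 0%N, (fun=> setT); split => // j; exact: filterT.
  - move=> V V' [n [B [nB BV]]] [n' [B' [nB' BV']]].
    exists (maxn n n'), (fun j => B j `&` B' j); split=> [j|z h]; first exact: filterI.
    split; [apply: BV|apply: BV'] => j jn; have [] := h j; rewrite ?leq_max ?jn ?orbT//.
  - by move=> V V' VV' [n [B [nB BV]]]; exists n, B; split => //; exact: subset_trans VV'.
have cvF : Fil --> y.
  apply/pointwise_cvgP => t U Ut; exists t, (fun j => if j == t then U else setT); split.
    by move=> j; case: eqVneq => [->//|_]; exact: filterT.
  by move=> z /(_ t (leqnn t)); rewrite eqxx.
have [n [B [nB BW]]] : Fil W by exact: cvF.
have /choice[C hC] j := contset_nbhs (y j) (B j) (nB j).
exists n, C; split=> [j||]; first by case: (hC j).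
  by move=> z Cz; apply: BW => j jn; case: (hC j) => _ _ _; apply; exact: Cz.
have proj t : (fun g : {ptws nat -> F} => g t) @ nbhs y --> y t.
  by move: t; apply/pointwise_cvgP; exact: cvg_id.
have step m : nbhs y [set z : {ptws nat -> F} | forall j, (j < m)%N -> C j (z j)].
  elim: m => [|m IH]; first by apply: filterS filterT => z _ j.
  have Cm : nbhs y [set z : {ptws nat -> F} | C m (z m)].
    by apply: (proj m); case: (hC m) => oC _ Cy _; exact: open_nbhs_nbhs.
  apply: filterS (filterI IH Cm) => z [/= h1 h2] j.
  by rewrite ltnS leq_eqVlt => /orP[/eqP->//|]; exact: h1.
exact: (step n.+1).
Qed.

(** The pieces may overlap: y takes the value of the first piece in the list that contains it, and
    the factor 1 - [\1_(r i)] passes the other points on. This product is why the family must be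
    closed under intersection. *)
Lemma lspan_piecewise {Y : Type} (G : set (set Y)) (I : eqType) (L : seq I) (r : I -> set Y)
  (c : I -> R) (f : Y -> R) (e : R) : setI_closed G -> G setT ->
  (forall i, G (r i)) -> (forall i y, r i y -> `|f y - c i| <= e) ->
  exists2 s, lspan G s & forall y, (exists2 i, i \in L & r i y) -> `|f y - s y| <= e.
Proof.
move=> GI GT Gr fr; elim: L => [|i L [s Gs hs]].
  by exists (fun=> 0); [exact: lspan_cst|move=> y []].
exists (fun y => c i * \1_(r i) y + (1 - \1_(r i) y) * s y).
  have Gi : lspan G (\1_(r i) : Y -> R) by exact: lspan_indic.
  apply: lspanD; first exact: lspanZ.
  by apply: lspanM => //; apply: lspanB => //; exact: lspan_cst.
move=> y [j]; rewrite in_cons => jL rj.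
have [ri|ri] := pselect (r i y).
  by rewrite indic1// mulr1 subrr mul0r addr0; exact: fr.
rewrite indic0N// mulr0 add0r subr0 mul1r; apply: hs.
by case/predU1P : jL rj => [->//|jL] rj; exists j.
Qed.

Lemma rects_dense (f : {ptws nat -> F} -> R) (e : R) : compact [set: F] ->
  continuous f -> 0 < e ->
  exists2 s : (nat -> F) -> R, lspan rects s & forall y, `|f y - s y| <= e.
Proof.
move=> cF cf e0.
have nb (y : {ptws nat -> F}) : exists V : set {ptws nat -> F},
    [/\ rects V, nbhs y V & forall z, V z -> `|f z - f y| <= e].
  have : nbhs y [set z | `|f z - f y| <= e].
    have /cvgrPdist_le/(_ e e0) := cf y.
    by apply: filterS => z; rewrite distrC.
  by move=> /rect_nbhs[n [B [cB BW nB]]]; exists (rect n B); split => //; exists n, B.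
have /choice[V hV] := nb.
have cpt : compact [set: {ptws nat -> F}].
  have := @tychonoff nat (fun=> F) (fun=> setT) (fun=> cF).
  by congr compact; apply/seteqP.
move/compact_near_coveringP : cpt => cpt.
(* A property holds near [Fil] if it holds for all lists extending some fixed list; near-covering
   compactness along this filter then delivers a finite subcover as a list. *)
pose Fil : set_system (seq {ptws nat -> F}) :=
  filter_from setT (fun L0 : seq {ptws nat -> F} => [set L : seq {ptws nat -> F} | {subset L0 <= L}]).
have FF : Filter Fil.
  apply: filter_from_filter; first by exists [::].
  move=> L1 L2 _ _; exists (L1 ++ L2) => // L h; split=> z zL; apply: h.
    by rewrite mem_cat zL.
  by rewrite mem_cat zL orbT.
have [L _ hL] : \forall L \near Fil, [set: {ptws nat -> F}] `<=`
    [set y | exists2 z, z \in L & V z y].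
  apply: (cpt _ Fil (fun L y => exists2 z, z \in L & V z y)) => y _.
  exists (V y, [set L : seq {ptws nat -> F} | y \in L]).
    split => /=; first by case: (hV y).
    by exists [:: y] => // L h; apply: h; rewrite mem_head.
  by move=> [z L] [/= Vz yL]; exists y.
have [s Gs hs] := lspan_piecewise rects {ptws nat -> F} L V f f e rectsI rectsT
  (fun y => let: And3 a _ _ := hV y in a) (fun y => let: And3 _ _ a := hV y in a).
exists s => // y; apply: hs; exact: (hL L).
Qed.

End rectangles.

(** * Limits of integrals along rectangles *)

Lemma bmf_uniform_limit {R : realType} {d : measure_display} {Y : measurableType d}
  (f : Y -> R) :
  (forall e : R, 0 < e -> exists2 g : Y -> R, bmf g & forall x, `|f x - g x| <= e) -> bmf f.
Proof.
move=> h.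
have /choice[g hg] : forall n : nat, exists g : Y -> R, bmf g /\
    forall x, `|f x - g x| <= n.+1%:R^-1.
  by move=> n; have [|g bg gf] := h n.+1%:R^-1; [rewrite invr_gt0|exists g].
split.
  apply: (measurable_fun_cvg (h := g)) => [m|x _]; first by case: (hg m) => -[].
  apply/cvgrPdist_le => e e0; have [n hn] := ex_nat_gt e^-1.
  exists n => // m /= nm; have [_ /(_ x)] := hg m => /le_trans; apply.
  rewrite -[leRHS]invrK lef_pV2 ?posrE ?invr_gt0// (le_trans (ltW hn))// ler_nat.
  exact: leqW.
have [g0 [_ [C gC]] fg] := h 1 ltr01.
exists (C + 1) => x; rewrite -(subrK (g0 x) (f x)) addrC.
by rewrite (le_trans (ler_normD _ _))// lerD.
Qed.

Section null_patch.
Context {R : realType} {d : measure_display} {X : measurableType d}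
  (mu : {measure set X -> \bar R}) (I : set X).
Hypothesis mI : measurable I.
Hypothesis I0 : mu (~` I) = 0%E.
Import HBNNSimple.

(* [g] is not assumed measurable: where a point never returns to A, the local
   processes evaluate psi_A outside A. *)
Lemma ge0_integral_null_patch (g : X -> \bar R) : (forall x, 0 <= g x)%E ->
  (\int[mu]_x g x = \int[mu]_x (g \_ I) x)%E.
Proof.
move=> g0; have gI0 x : (0 <= (g \_ I) x)%E by rewrite patchE; case: ifP.
rewrite ge0_integralTE// [RHS]ge0_integralTE//.
apply/eqP; rewrite eq_le; apply/andP; split; apply: ge_ereal_sup => _ [h hg <-].
  have -> : sintegral mu h = sintegral mu (proj_nnsfun h mI).
    rewrite -!integralT_nnsfun (ge0_negligible_integral (measurableC mI) measurableT _ _ I0).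
    - rewrite setTD setCK integral_mkcond; apply: eq_integral => x _.
      by rewrite -(mrestrict h mI) !patchE; case: ifP.
    - by apply/measurable_EFinP.
    - by move=> x _; rewrite lee_fin.
  apply: ereal_sup_ubound; exists (proj_nnsfun h mI) => // x.
  by rewrite -(mrestrict h mI) !patchE; case: ifP.
apply: ereal_sup_ubound; exists h => // x; apply: (le_trans (hg x)).
by rewrite patchE; case: ifP.
Qed.

Lemma integral_null_patch (g : X -> \bar R) :
  (\int[mu]_x g x = \int[mu]_x (g \_ I) x)%E.
Proof.
rewrite integralE [RHS]integralE funepos_restrict funeneg_restrict.
by rewrite -!ge0_integral_null_patch.
Qed.

End null_patch.

(** [g] need be bounded and measurable only on the part of D inside the full-measure set I, which
    for the local processes is [visits_io]. *)
Lemma Rint_EFin {R : realType} {d : measure_display} {X : measurableType d}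
  (mu : probability X R) (D I : set X) (g : X -> R) : measurable I -> pr mu I = 1 ->
  bmf (fun x => \1_(D `&` I) x * g x) ->
  (\int[mu]_(x in D) (g x)%:E = (\int[mu]_x (\1_(D `&` I) x * g x))%:E)%E.
Proof.
move=> mI I1 bg; have I0 : mu (~` I) = 0%E.
  by rewrite prE; [rewrite pr_setC// I1 subrr|exact: measurableC].
rewrite integral_mkcond (integral_null_patch _ _ mI I0) -patch_setI /Rintegral fineK; last first.
  exact: (integrable_fin_num measurableT (bmf_integrable mu _ bg)).
apply: eq_integral => x _; rewrite patchE indicE setIC.
by case: (_ \in _); rewrite ?mul1r ?mul0r.
Qed.

Lemma pr_full {R : realType} {d : measure_display} {X : measurableType d}
  (mu : probability X R) (I E : set X) : measurable I -> measurable E -> pr mu I = 1 ->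
  pr mu (I `&` E) = pr mu E.
Proof.
move=> mI mE I1; have mIC : measurable (~` I) by exact: measurableC.
rewrite [RHS](pr_split mu E I)// setIC.
rewrite (pr_eq0 mu (E `&` ~` I) (~` I)) ?addr0//; first exact: measurableI.
by rewrite pr_setC// I1 subrr.
Qed.

Lemma Rint_dist_le {R : realType} {d : measure_display} {X : measurableType d}
  (m : probability X R) (D : set X) (g h : X -> R) (e : R) : measurable D ->
  bmf (fun x => \1_D x * g x) -> bmf (fun x => \1_D x * h x) ->
  (forall x, `|g x - h x| <= e) ->
  `|\int[m]_x (\1_D x * g x) - \int[m]_x (\1_D x * h x)| <= e * pr m D.
Proof.
move=> mD bg bh gh; rewrite -RintB//; apply: (le_trans (Rint_norm _ _ _)); first exact: bmfB.
have bD : bmf (\1_D : X -> R) by exact: bmf_indic.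
rewrite -Rint_indic// -RintZ//; apply: le_Rint.
- by apply: bmf_norm; exact: bmfB.
- by apply: bmfM => //; exact: bmf_cst.
move=> x; rewrite -mulrBr normrM ger0_norm ?indic_ge0// mulrC.
by apply: ler_wpM2r; rewrite ?indic_ge0.
Qed.

Section rects_limit.
Context {R : realType} {F : pseudoPMetricType R} (M : probability (borelT F) R).
Hypothesis cF : compact [set: F].

Lemma bmf_lspan_rects {d : measure_display} {Y : measurableType d} (D : set Y)
  (Z : Y -> nat -> F) (s : (nat -> F) -> R) :
  (forall E, rects M E -> measurable (D `&` Z @^-1` E)) -> lspan (rects M) s ->
  bmf (fun x => \1_D x * s (Z x)).
Proof.
move=> mE; elim=> [B /mE mB|a b f g _ IH1 _ IH2].
  rewrite (_ : (fun x => _) = \1_(D `&` Z @^-1` B)); first exact: bmf_indic.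
  by apply/funext => x; rewrite indicI.
rewrite (_ : (fun x => _) = (fun x => a * (\1_D x * f (Z x)) + b * (\1_D x * g (Z x)))).
  by apply: bmfD; apply: bmfM => //; exact: bmf_cst.
by apply/funext => x; ring.
Qed.

Lemma bmf_continuous_rects {d : measure_display} {Y : measurableType d} (D : set Y)
  (Z : Y -> nat -> F) (f : {ptws nat -> F} -> R) :
  (forall E, rects M E -> measurable (D `&` Z @^-1` E)) -> continuous f ->
  bmf (fun x => \1_D x * f (Z x)).
Proof.
move=> mE cf; apply: bmf_uniform_limit => e e0.
have [s Gs fs] := rects_dense M f e cF cf e0.
exists (fun x => \1_D x * s (Z x)); first exact: bmf_lspan_rects.
move=> x; rewrite -mulrBr normrM ger0_norm ?indic_ge0// -[leRHS]mul1r.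
by apply: ler_pM; rewrite ?indic_ge0 ?indic_le1//; exact: fs.
Qed.

(** The weights let one statement serve both limits: [c l] is 1 / mu(A_l) for the law under
    mu_(A_l), and 1 for the law under mu. The bound on [c l * pr mu (D l)] keeps the uniform
    approximation error from being amplified. *)
Lemma rects_limit {d d' : measure_display} {X : measurableType d} {Om : measurableType d'}
  (mu : probability X R) (P : probability Om R) (D : nat -> set X) (c : nat -> R)
  (Z : nat -> X -> nat -> F) (Y : Om -> nat -> F) :
  (forall l, 0 <= c l) -> (forall l, c l * pr mu (D l) <= 1) ->
  (forall l E, rects M E -> measurable (D l `&` Z l @^-1` E)) ->
  (forall E, rects M E -> measurable (setT `&` Y @^-1` E)) ->
  (forall E, rects M E ->
    c l * pr mu (D l `&` Z l @^-1` E) @[l --> \oo] --> pr P (setT `&` Y @^-1` E)) ->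
  forall f : {ptws nat -> F} -> R, continuous f ->
  c l * \int[mu]_x (\1_(D l) x * f (Z l x)) @[l --> \oo] -->
    \int[P]_w (\1_setT w * f (Y w)).
Proof.
move=> c0 c1 mZ mY EE f cf.
have bf l := bmf_continuous_rects (D l) (Z l) f (mZ l) cf.
have bfY := bmf_continuous_rects setT Y f mY cf.
apply/cvgrPdist_lt => e e0; have e4 : 0 < e / 4 by lra.
have [s Gs fs] := rects_dense M f (e / 4) cF cf e4.
have bs l t (Gt : lspan (rects M) t) := bmf_lspan_rects (D l) (Z l) t (mZ l) Gt.
have bsY t (Gt : lspan (rects M) t) := bmf_lspan_rects setT Y t mY Gt.
have cvs : c l * \int[mu]_x (\1_(D l) x * s (Z l x)) - \int[P]_w (\1_setT w * s (Y w))
    @[l --> \oo] --> (0 : R).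
  apply: (lspan_cvg (rects M) (fun l s => c l * \int[mu]_x (\1_(D l) x * s (Z l x)) -
     \int[P]_w (\1_setT w * s (Y w)))) => //.
    move=> l a b g h Gg Gh.
    have -> : \int[mu]_x (\1_(D l) x * (a * g (Z l x) + b * h (Z l x))) =
      a * \int[mu]_x (\1_(D l) x * g (Z l x)) + b * \int[mu]_x (\1_(D l) x * h (Z l x)).
      rewrite -!RintZ; [|exact: bs..].
      rewrite -RintD; [|by apply: bmfM; [exact: bmf_cst|exact: bs]..].
      by apply: eq_Rintegral => x _; ring.
    have -> : \int[P]_x (\1_setT x * (a * g (Y x) + b * h (Y x))) =
      a * \int[P]_x (\1_setT x * g (Y x)) + b * \int[P]_x (\1_setT x * h (Y x)).
      rewrite -!RintZ; [|exact: bsY..].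
      rewrite -RintD; [|by apply: bmfM; [exact: bmf_cst|exact: bsY]..].
      by apply: eq_Rintegral => x _; ring.
    by ring.
  move=> E GE; apply/subr_cvg0; have mYE := mY E GE.
  have -> : \int[P]_w (\1_setT w * \1_E (Y w)) = pr P (setT `&` Y @^-1` E).
    by rewrite -Rint_indic//; apply: eq_Rintegral => w _; rewrite indicI.
  have -> : (fun l => c l * \int[mu]_x (\1_(D l) x * \1_E (Z l x))) =
            (fun l => c l * pr mu (D l `&` Z l @^-1` E)).
    apply/funext => l; have mZE := mZ l E GE.
    by congr (_ * _); rewrite -Rint_indic//; apply: eq_Rintegral => x _; rewrite indicI.
  exact: EE.
have mD l : measurable (D l) by have := mZ l _ (rectsT M); rewrite preimage_setT setIT.
have hY := Rint_dist_le P setT _ _ _ measurableT bfY (bsY _ Gs) (fun w => fs (Y w)); rewrite pr_setT mulr1 in hY.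
move/cvgrPdist_lt : cvs => /(_ _ e4); apply: filterS => l.
rewrite sub0r normrN => hl.
have hX : `|c l * \int[mu]_x (\1_(D l) x * f (Z l x)) -
    c l * \int[mu]_x (\1_(D l) x * s (Z l x))| <= e / 4.
  rewrite -mulrBr normrM ger0_norm//.
  apply: (le_trans (ler_wpM2l (c0 l) (Rint_dist_le mu (D l) _ _ _ (mD l) (bf l) (bs l _ Gs) (fun x => fs (Z l x))))).
  rewrite mulrCA -[leRHS]mulr1 ler_wpM2l//; exact: ltW.
move: hl hX hY; rewrite !ltr_norml !ler_norml => /andP[? ?] /andP[? ?] /andP[? ?].
by apply/andP; split; lra.
Qed.

End rects_limit.

(** * Cylinder events of the local processes *)

Lemma cvgr_eq {R : realType} (u v : nat -> R) (a b : R) : u =1 v -> a = b ->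
  u @ \oo --> a -> v @ \oo --> b.
Proof. by move=> /funext -> ->. Qed.

Lemma mul_inv_pr {R : realType} {d : measure_display} {X : measurableType d}
  (mu : probability X R) (A : set X) (a : R) : measurable A -> 0 < pr mu A ->
  (a%:E * (mu A)^-1)%E = ((pr mu A)^-1 * a)%:E.
Proof. by move=> mA A0; rewrite prE// inver gt_eqF// -EFinM mulrC. Qed.

Section conditional_Probs.
Context {R : realType} {d : measure_display} {X : measurableType d}
  (mu : set X -> \bar R).

Lemma Probs_of_measure (m : {measure set X -> \bar R}) (nu : set X -> \bar R) :
  (forall B, measurable B -> nu B = m B) -> m setT = 1%E ->
  (forall B, measurable B -> mu B = 0%E -> m B = 0%E) -> Probs mu nu.
Proof.
move=> nuE m1 mac; split.
- by rewrite nuE// measure0.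
- by move=> B mB; rewrite nuE.
- move=> B mB tB mU; rewrite nuE//.
  under eq_fun do under eq_bigr do rewrite nuE//.
  exact: measure_semi_sigma_additive.
- by rewrite nuE.
- by move=> B mB mu0; rewrite nuE// mac.
Qed.

(** Conditioning on a null set gives the zero set function, so total mass 1 certifies that the
    condition is not null. *)
Lemma condm_neq0 (nu : set X -> \bar R) S : condm nu S setT = 1%E -> nu S <> 0%E.
Proof.
move=> + S0; rewrite /condm setIT S0 mul0e => /esym/eqP.
by rewrite eqe oner_eq0.
Qed.

Lemma condmE (nu : set X -> \bar R) S B : Probs mu nu -> measurable S -> measurable B ->
  0 < pr nu S -> condm nu S B = ((pr nu S)^-1 * pr nu (S `&` B))%:E.
Proof.
move=> Pnu mS mB S0; have [p [pE _]] := ProbsP _ _ Pnu.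
have nuE C : measurable C -> nu C = (pr nu C)%:E.
  by move=> mC; rewrite /pr fineK// pE// fin_num_measure.
have mSB : measurable (S `&` B) by exact: measurableI.
by rewrite /condm (nuE S)// (nuE (S `&` B))// inver gt_eqF// -EFinM mulrC.
Qed.

Lemma pr_condm (nu : set X -> \bar R) S B : Probs mu nu -> measurable S -> measurable B ->
  0 < pr nu S -> pr (condm nu S) B = (pr nu S)^-1 * pr nu (S `&` B).
Proof. by move=> Pnu mS mB S0; rewrite /pr condmE. Qed.

Lemma Probs_condm (nu : set X -> \bar R) S : Probs mu nu -> measurable S ->
  0 < pr nu S -> Probs mu (condm nu S).
Proof.
move=> Pnu mS S0; have [p [pE pac]] := ProbsP _ _ Pnu.
have k0 : 0 <= (pr nu S)^-1 by rewrite invr_ge0 ltW.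
have E B : measurable B -> condm nu S B = mscale (NngNum k0) (mrestr p mS) B.
  move=> mB; have mSB : measurable (B `&` S) by exact: measurableI.
  rewrite condmE// setIC EFinM /mscale/= /mrestr; congr (_ * _)%E.
  by rewrite /pr fineK pE// fin_num_measure.
apply: (Probs_of_measure _ _ E).
- rewrite -[LHS]/(mscale _ _ _) -E// condmE// setIT mulVf//; exact: lt0r_neq0.
- move=> B mB mu0; rewrite -[LHS]/(mscale _ _ _) /mscale/= /mrestr.
  rewrite (_ : p (B `&` S) = 0%E) ?mule0//.
  apply: (subset_measure0 (B := B)) => //; [exact: measurableI|exact: pac].
Qed.

End conditional_Probs.

Lemma Probs_self {R : realType} {d : measure_display} {X : measurableType d}
  (mu : probability X R) : Probs mu mu.
Proof. by apply: (Probs_of_measure mu mu) => //; exact: probability_setT. Qed.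

Section stopping.
Context {d : measure_display} {X : measurableType d} (T : X -> X)
  (tau : X -> nat).
Hypothesis mT : measurable_fun setT T.
Hypothesis mtau : measurable_fun setT tau.

Let mtauS (N : set nat) : measurable (tau @^-1` N).
Proof. by rewrite -[X in measurable X]setTI; exact: mtau. Qed.

Lemma measurable_before_return A : measurable A -> measurable (before_return T A tau).
Proof.
move=> mA; have -> : before_return T A tau = \bigcap_n
    ((tau @^-1` [set k | ~ (0 < n <= k)%N]) `|` ~` (iter n T @^-1` A)).
  apply/seteqP; split=> x h n => [_|nt].
    by have [nt|nt] := pselect (0 < n <= tau x)%N; [right; exact: h|left].
  by case: (h n Logic.I).
apply: bigcapT_measurable => n; apply: measurableU => //.
by apply: measurableC; exact: measurable_preiter.
Qed.

Lemma measurable_stopped B : measurable B -> measurable [set x | B (iter (tau x) T x)].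
Proof.
move=> mB; have -> : [set x | B (iter (tau x) T x)] =
    \bigcup_n ((tau @^-1` [set n]) `&` (iter n T @^-1` B)).
  apply/seteqP; split=> x /=; first by move=> h; exists (tau x).
  by move=> [n _ [/= -> ?]].
by apply: bigcupT_measurable => n; apply: measurableI => //; exact: measurable_preiter.
Qed.

End stopping.

Section cylinders.
Context {d : measure_display} {X : measurableType d} (T : X -> X) (A : set X)
  {Y : pointedType} (psi : X -> Y).

(* The event that the local process starts with values in [Bs]; the nested [hit_in]
   ensure that all the returns involved take place. *)
Fixpoint cyl (Bs : seq (set Y)) : set X :=
  if Bs is B :: Bs' then
    hit_in T A ((A `&` (psi \_ A) @^-1` B) `&` cyl Bs')
  else setT.

Lemma cyl_shift Bs x : ~ A (T x) -> cyl Bs x <-> cyl Bs (T x).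
Proof. by case: Bs => //= B Bs; exact: hit_in_shift. Qed.

Lemma cyl_before tau Bs x : before_return T A tau x ->
  cyl Bs x <-> cyl Bs (iter (tau x) T x).
Proof. by case: Bs => //= B Bs h; exact: hit_in_before. Qed.

Lemma cyl_visits Bs x : visits_io T A x -> cyl Bs x <->
  forall j, (j < size Bs)%N -> nth setT Bs j (local_process T A psi x j).
Proof.
elim: Bs x => [//|B Bs IH] x Vx; have Vx' := visits_io_induced _ _ _ Vx.
have [_ ATx _] := ret_timeP _ _ _ (visits_io_returns _ _ _ Vx).
have ph : (psi \_ A) (induced_map T A x) = local_process T A psi x 0.
  by rewrite patchE mem_set.
rewrite [cyl _]/= hit_in_visits//; split.
  move=> [[_ Bx] /(IH _ Vx') Bsx] [_|j js]; first by rewrite -ph.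
  by have := Bsx j js; rewrite /local_process -iterSr.
move=> h; split; first by split => //=; rewrite /preimage/= ph; exact: (h 0%N).
apply/(IH _ Vx') => j js; have := h j.+1 js.
by rewrite /local_process iterSr.
Qed.

End cylinders.

(** * Asymptotic independence and the limit of the local processes *)

Section main.
Context {R : realType} {d : measure_display} {X : measurableType d}
  (mu : probability X R) (T : X -> X) {F : pseudoPMetricType R}
  (A : nat -> set X) (psiA : nat -> X -> F) (M : probability (borelT F) R)
  (Bpi : set (set F)).
Hypothesis hF : hausdorff_space F.
Hypothesis cF : compact [set: F].
Hypothesis mpT : measure_preserving mu T.
Hypothesis ergT : ergodic mu T.
Hypothesis mA : forall l, measurable (A l).
Hypothesis A_gt0 : forall l, 0 < pr mu (A l).
Hypothesis A_cvg : pr mu (A l) @[l --> \oo] --> (0 : R).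
Hypothesis mpsi : forall l, measurable_fun (A l) (psiA l : X -> borelT F).

Let mT : measurable_fun setT T. Proof. by case: mpT. Qed.

Let phi l : X -> borelT F := psiA l \_ (A l).

Let mphi l : measurable_fun setT (phi l).
Proof. exact: (measurable_restrictT (psiA l : X -> borelT F) (mA l)).1 (mpsi l). Qed.

Let mphiB l (B : set (borelT F)) : measurable B -> measurable (phi l @^-1` B).
Proof. by move=> mB; rewrite -[X in measurable X]setTI; exact: mphi. Qed.

(* mu_A-expectation of [g o psi_A] on the event [D] *)
Definition cexp l (D : set X) (g : F -> R) : R :=
  (pr mu (A l))^-1 * \int[mu]_x (\1_(A l `&` D) x * g ((psiA l \_ (A l)) x)).

Let bcexp l D g : measurable D -> bmf (g : borelT F -> R) ->
  bmf (fun x => \1_(A l `&` D) x * g (phi l x)).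
Proof.
move=> mD bg; apply: bmfM; first by apply: bmf_indic; exact: measurableI.
exact: (bmf_comp g (phi l)).
Qed.

Lemma cexp_lin l D a b g h : measurable D -> bmf (g : borelT F -> R) ->
  bmf (h : borelT F -> R) ->
  cexp l D (fun x => a * g x + b * h x) = a * cexp l D g + b * cexp l D h.
Proof.
move=> mD bg bh; rewrite /cexp.
have -> : \int[mu]_x (\1_(A l `&` D) x * (a * g (phi l x) + b * h (phi l x))) =
  \int[mu]_x (a * (\1_(A l `&` D) x * g (phi l x)) + b * (\1_(A l `&` D) x * h (phi l x))).
  by apply: eq_Rintegral => x _; ring.
have b1 := bcexp l D g mD bg; have b2 := bcexp l D h mD bh.
rewrite RintD; [|by apply: bmfM => //; exact: bmf_cst..].
by rewrite !RintZ//; ring.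
Qed.

Lemma le_cexp l D g h : measurable D -> bmf (g : borelT F -> R) ->
  bmf (h : borelT F -> R) -> (forall x, g x <= h x) -> cexp l D g <= cexp l D h.
Proof.
move=> mD bg bh gh; rewrite /cexp ler_pM2l ?invr_gt0//; apply: le_Rint; [exact: bcexp..|].
by move=> x; rewrite ler_wpM2l// indic_ge0.
Qed.

Lemma le_cexp_set l D D' g : measurable D -> measurable D' -> D `<=` D' ->
  bmf (g : borelT F -> R) -> (forall x, 0 <= g x) -> cexp l D g <= cexp l D' g.
Proof.
move=> mD mD' DD' bg g0; rewrite /cexp ler_pM2l ?invr_gt0//; apply: le_Rint; [exact: bcexp..|].
move=> x; rewrite ler_wpM2r//.
have [[Ax Dx]|h] := pselect ((A l `&` D) x); last by rewrite indic0N// indic_ge0.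
by rewrite !indic1//; split => //; exact: DD'.
Qed.

Lemma cexp_indic l D B : measurable D -> measurable (B : set (borelT F)) ->
  cexp l D \1_B = (pr mu (A l))^-1 * pr mu ((A l `&` (psiA l \_ (A l)) @^-1` B) `&` D).
Proof.
move=> mD mB; have mI : measurable ((A l `&` (psiA l \_ (A l)) @^-1` B) `&` D).
  by apply: measurableI => //; apply: measurableI => //; exact: mphiB.
rewrite /cexp -(Rint_indic mu _ mI).
congr (_ * _); apply: eq_Rintegral => x _; rewrite !indicI/= -!mulrA.
by congr (_ * _); rewrite mulrC.
Qed.

Lemma cexp_le_setT l D g : measurable D -> bmf (g : borelT F -> R) ->
  `|cexp l D g| <= cexp l setT (fun x => `|g x|).
Proof.
move=> mD bg; have bn : bmf ((fun x => `|g x|) : borelT F -> R) by exact: bmf_norm.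
have bN : bmf ((fun x => (-1) * `|g x| + 0 * `|g x|) : borelT F -> R).
  by apply: bmfD; apply: bmfM => //; exact: bmf_cst.
have h1 : cexp l D g <= cexp l D (fun x => `|g x|).
  by apply: le_cexp => // x; exact: ler_norm.
have h2 : cexp l D (fun x => (-1) * `|g x| + 0 * `|g x|) <= cexp l D g.
  by apply: le_cexp => // x; rewrite mul0r addr0 mulN1r lerNl -normrN ler_norm.
have h3 : cexp l D (fun x => `|g x|) <= cexp l setT (fun x => `|g x|).
  exact: le_cexp_set.
rewrite cexp_lin// in h2.
by rewrite ler_norml; apply/andP; split; lra.
Qed.

Lemma cexp_cst l c : cexp l setT (fun=> c) = c.
Proof.
rewrite /cexp setIT.
have -> : \int[mu]_x (\1_(A l) x * c) = c * pr mu (A l).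
  rewrite -Rint_indic// -RintZ; last exact: bmf_indic.
  by apply: eq_Rintegral => x _; rewrite mulrC.
rewrite mulrCA mulVf ?mulr1//; exact: lt0r_neq0.
Qed.

Hypothesis weak : forall f : F -> R, continuous f -> bounded_fun f ->
  cexp l setT f @[l --> \oo] --> \int[M]_x f x.
Hypothesis BpiT : Bpi setT.
Hypothesis BpiI : setI_closed Bpi.
Hypothesis BpiE : <<s Bpi >> = <<s @open F >>.
Hypothesis Bpi_boundary : forall B, Bpi B -> pr M (boundary B) = 0.

Let mBpi B : Bpi B -> measurable (B : set (borelT F)).
Proof.
move=> BB; rewrite -[measurable _]/(<<s @open F >> B) -BpiE; exact: sub_gen_smallest.
Qed.

Let Bpi_contset : Bpi `<=` contset M.
Proof. by move=> B BB; split; [exact: mBpi|exact: Bpi_boundary]. Qed.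

Let lspan_contset_bmf f : lspan (contset M) f -> bmf (f : borelT F -> R).
Proof.
elim=> [B [mB _]|a b f1 f2 _ IH1 _ IH2]; first exact: bmf_indic.
by apply: bmfD; apply: bmfM => //; exact: bmf_cst.
Qed.

Lemma cexp_contset B : contset M B -> cexp l setT \1_B @[l --> \oo] --> pr M B.
Proof.
apply: (portmanteau hF cF M (fun l => cexp l setT)) => //.
by move=> l f g; exact: le_cexp.
Qed.

Lemma cexp_lspan f : lspan (contset M) f ->
  cexp l setT f @[l --> \oo] --> \int[M]_x f x.
Proof.
move=> Gf; apply/subr_cvg0.
apply: (lspan_cvg (contset M) (fun l f => cexp l setT f - \int[M]_x f x)) => //.
  move=> l a b g h Gg Gh; have bg := lspan_contset_bmf _ Gg; have bh := lspan_contset_bmf _ Gh.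
  rewrite cexp_lin// RintD; [|by apply: bmfM => //; exact: bmf_cst..].
  by rewrite !RintZ//; ring.
move=> B cB; apply/subr_cvg0; rewrite Rint_indic; first exact: cexp_contset.
by case: cB.
Qed.

(** 1_C is replaced by an element g of the span of [Bpi], for which the limit is already known by
    linearity. The replacement error t is small in L^1 both under M and, for large l, under the law
    of psi_(A_l). *)
Lemma cexp_extend (V : nat -> set X) (v : nat -> R) :
  (forall l, measurable (V l)) -> (forall l, 0 <= v l <= 1) ->
  (forall B, Bpi B -> cexp l (V l) \1_B - pr M B * v l @[l --> \oo] --> (0 : R)) ->
  forall C, contset M C -> cexp l (V l) \1_C - pr M C * v l @[l --> \oo] --> (0 : R).
Proof.
move=> mV v01 hB C cC; have [mC _] := cC.
apply/cvgrPdist_lt => e e0; pose r := e / 8.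
have r0 : 0 < r by rewrite /r; lra.
have rr0 : 0 < r * r by exact: mulr_gt0.
have GE : @measurable _ (borelT F) = <<s Bpi >> by rewrite BpiE.
have [g Gg hg] := lspan_dense M Bpi GE BpiI BpiT C (r * r) mC rr0.
have Ug : lspan (contset M) g by apply: lspanS Gg.
have bg := lspan_contset_bmf _ Ug.
have bC : bmf (\1_C : borelT F -> R) by exact: bmf_indic.
pose t x := \1_C x - g x : R.
have Ut : lspan (contset M) t by apply: lspanB => //; exact: lspan_indic.
have bt := lspan_contset_bmf _ Ut.
(* The square stays in the span, so its expectation under mu_(A_l) tends to its M-integral, at most
   r^2. *)
have Ut2 : lspan (contset M) (fun x => t x * t x).
  by apply: lspanM => //; exact: contsetI.
have bt2 := lspan_contset_bmf _ Ut2.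
have Mt2 : \int[M]_x (t x * t x) <= r * r.
  by apply: le_trans hg; rewrite le_eqVlt; apply/orP; left; apply/eqP.
(* r |t| <= t^2 + r^2 stands in for Cauchy-Schwarz: a second moment of order r^2 bounds the first by
   order r. *)
have nt x : `|t x| <= r^-1 * (t x * t x) + r * 1.
  rewrite mulr1 -(ler_pM2l r0) mulrDr.
  have -> : r * (r^-1 * (t x * t x)) = `|t x| * `|t x|.
    by rewrite mulVKf ?gt_eqF// -normrM ger0_norm// -expr2 sqr_ge0.
  have := normr_ge0 (t x); nra.
have b1 : bmf ((fun=> 1) : borelT F -> R) by exact: bmf_cst.
have bnt : bmf ((fun x => `|t x|) : borelT F -> R) by exact: bmf_norm.
have bq : bmf ((fun x => r^-1 * (t x * t x) + r * 1) : borelT F -> R).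
  by apply: bmfD; apply: bmfM => //; exact: bmf_cst.
have Mt : `|\int[M]_x t x| <= 2 * r.
  apply: (le_trans (Rint_norm _ _ bt)).
  apply: (le_trans (le_Rint _ _ _ bnt bq nt)).
  rewrite RintD; [|by apply: bmfM => //; exact: bmf_cst..].
  rewrite !RintZ// Rint_cst mulr1.
  have : r^-1 * \int[M]_x (t x * t x) <= r by rewrite ler_pdivrMl.
  lra.
have H1 : cexp l (V l) g - \int[M]_x g x * v l @[l --> \oo] --> (0 : R).
  apply: (lspan_cvg Bpi (fun l f => cexp l (V l) f - \int[M]_x f x * v l)) => //.
    move=> l a b f h Gf Gh; have bf := lspan_contset_bmf _ (lspanS _ _ _ Bpi_contset Gf).
    have bh := lspan_contset_bmf _ (lspanS _ _ _ Bpi_contset Gh).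
    rewrite cexp_lin// RintD; [|by apply: bmfM => //; exact: bmf_cst..].
    by rewrite !RintZ//; ring.
  by move=> B BB; rewrite Rint_indic; [exact: hB|exact: mBpi].
have H2 := cexp_lspan _ Ut2.
move/cvgrPdist_lt : H1 => /(_ _ r0) H1; move/cvgrPdist_lt : H2 => /(_ _ rr0) H2.
near=> l.
have h1 : `|0 - (cexp l (V l) g - \int[M]_x g x * v l)| < r by near: l.
have h2 : `|\int[M]_x (t x * t x) - cexp l setT (fun x => t x * t x)| < r * r by near: l.
have h3 : `|cexp l (V l) t| <= 3 * r.
  apply: (le_trans (cexp_le_setT _ _ _ _ bt)) => //.
  apply: (le_trans (le_cexp l setT _ _ measurableT bnt bq nt)).
  rewrite cexp_lin// cexp_cst mulr1.
  have : r^-1 * cexp l setT (fun x => t x * t x) <= 2 * r; last by lra.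
  rewrite ler_pdivrMl//; move: h2; rewrite ltr_norml => /andP[h2 _]; nra.
have h4 : cexp l (V l) t = cexp l (V l) \1_C - cexp l (V l) g.
  have -> : t = (fun x => 1 * \1_C x + (-1) * g x).
    by apply/funext => x; rewrite /t; ring.
  by rewrite cexp_lin//; ring.
have h5 : \int[M]_x t x = pr M C - \int[M]_x g x.
  by rewrite RintB// Rint_indic.
have /andP[v0 v1] := v01 l.
move: h1 h3 Mt; rewrite h4 h5 sub0r normrN => h1 h3 Mt.
move: h1 h3 Mt; rewrite ltr_norml !ler_norml => /andP[h1 h1'] /andP[h3 h3'] /andP[Mt1 Mt2'].
have er : e = 8 * r by rewrite /r; lra.
by rewrite sub0r normrN ltr_norml er; apply/andP; split; nra.
Unshelve. all: by end_near.
Qed.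

Hypothesis H2 : forall eps : R, 0 < eps ->
  exists nu : nat -> set X -> \bar R,
    [/\ forall l, Probs mu (nu l),
        forall l, (dP (nu l) (condm mu (A l)) < eps%:E)%E &
        forall B, Bpi B -> 0 < pr M B ->
        exists2 K : set (set X -> \bar R), compactP mu K &
        exists nuF : nat -> set X -> \bar R,
        exists tau : nat -> X -> nat,
          [/\ forall l, Probs mu (nuF l),
              (fun l => dP (nuF l) (condm (nu l) (A l `&` psiA l @^-1` B)))
                @ \oo --> 0%E,
              forall l, measurable_fun setT (tau l),
              (fun l => nuF l (before_return T (A l) (tau l)))
                @ \oo --> 1%E &
              forall l, K (push T (tau l) (nuF l))]].

Lemma measurable_cyl l (Bs : seq (set F)) : (forall B, B \in Bs -> measurable (B : set (borelT F))) ->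
  measurable (cyl T (A l) (psiA l) Bs).
Proof.
elim: Bs => [_|B Bs IH mBs]; first exact: measurableT.
apply: measurable_hit_in => //; apply: measurableI.
  by apply: measurableI => //; apply: mphiB; apply: mBs; rewrite mem_head.
by apply: IH => C CB; apply: mBs; rewrite in_cons CB orbT.
Qed.

(** With S the event that psi_A lies in B and C the cylinder: mu_A(S and C) is close to nu(S and C)
    = nu(S) nu_S(C). Here nu_S(C) is close to nuF(C), then to the pushed mass of C, then to mu(C),
    while nu(S) is close to mu_A(S) and so to M(B). *)
Lemma cexp_Bpi B (Bs : seq (set F)) : Bpi B -> (forall C, C \in Bs -> measurable (C : set (borelT F))) ->
  cexp l (cyl T (A l) (psiA l) Bs) \1_B - pr M B * pr mu (cyl T (A l) (psiA l) Bs)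
    @[l --> \oo] --> (0 : R).
Proof.
move=> BB mBs; pose C l := cyl T (A l) (psiA l) Bs.
have mC l : measurable (C l) by exact: measurable_cyl.
have mB := mBpi _ BB.
pose S l := A l `&` psiA l @^-1` B.
have SE l : S l = A l `&` (psiA l \_ (A l)) @^-1` B.
  by apply/seteqP; split=> x [Ax Bx]; split => //; move: Bx; rewrite /preimage/= patchE mem_set.
have mS l : measurable (S l) by rewrite SE; apply: measurableI => //; exact: mphiB.
have mSC l : measurable (S l `&` C l) by exact: measurableI.
have qE l : cexp l setT \1_B = (pr mu (A l))^-1 * pr mu (S l).
  by rewrite cexp_indic// setIT SE.
have xE l : cexp l (C l) \1_B = (pr mu (A l))^-1 * pr mu (S l `&` C l).
  by rewrite cexp_indic// SE.
have q_cvg := cexp_contset _ (Bpi_contset _ BB).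
have c01 l : 0 <= pr mu (C l) <= 1 by rewrite pr_ge0 pr_le1.
have x_ge0 l : 0 <= cexp l (C l) \1_B by rewrite xE mulr_ge0 ?invr_ge0 ?pr_ge0 ?ltW.
have x_le l : cexp l (C l) \1_B <= cexp l setT \1_B.
  by rewrite xE qE ler_pM2l ?invr_gt0//; apply: le_pr => // x [].
(* For an M-null B the hypothesis gives nothing, but the event lies inside S, whose mu_A-mass tends
   to 0. *)
have [MB0|MB0] := eqVneq (pr M B) 0.
  rewrite MB0 in q_cvg *; apply: (@squeeze_cvgr _ _ _ _ (fun=> 0) (fun l => cexp l setT \1_B)).
  - by apply: nearW => l; rewrite mul0r subr0 x_ge0 x_le.
  - exact: cvg_cst.
  - exact: q_cvg.
have MB : 0 < pr M B by rewrite lt_neqAle eq_sym MB0 pr_ge0.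
apply/cvgrPdist_lt => e e0.
(* The bound M(B) / 4 keeps nu(S) positive, since nu(S) is within 2r of M(B); e / 8 leaves room for
   six errors of size r. *)
pose r := Num.min (e / 8) (pr M B / 4).
have r0 : 0 < r by rewrite /r lt_min; apply/andP; split; lra.
have re : r <= e / 8 by rewrite /r ge_min lexx.
have rM : r <= pr M B / 4 by rewrite /r ge_min lexx orbT.
have [nu [Pnu dnu /(_ B BB MB)[K cK [nuF [tau [PF dF mtau bF KF]]]]]] := H2 r r0.
have uni := compactP_uniform mu K C cK mC.
have {}uni := uni (fun p e' pmu e'0 => ac_asymptotics mu T mpT ergT A C p e' mA mC A_cvg
   (fun l x => cyl_shift T (A l) (psiA l) Bs x) pmu e'0) r r0.
have Pmu := Probs_self mu.
have PA l : Probs mu (condm mu (A l)) by exact: Probs_condm.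
have nuA l D : measurable D ->
    `|pr (nu l) D - (pr mu (A l))^-1 * pr mu (A l `&` D)| < r.
  move=> mD; have := le_lt_trans (dP_bound mu _ _ D (Pnu l) (PA l) mD) (dnu l).
  rewrite lte_fin (pr_condm mu)//; have := normr_ge0 (pr (nu l) D - (pr mu (A l))^-1 * pr mu (A l `&` D)).
  lra.
have AS l : A l `&` S l = S l by rewrite /S setIA setIid.
have bFr : pr (nuF l) (before_return T (A l) (tau l)) @[l --> \oo] --> (1 : R).
  by rewrite /pr; exact: fine_cvg.
move/cvgrPdist_lt : bFr => /(_ _ r0) bFr.
move/cvgrPdist_lt : q_cvg => /(_ _ r0) q_cvg.
have dF2 : \forall l \near \oo, (dP (nuF l) (condm (nu l) (S l)) < r%:E)%E.
  by apply: (dF [set x | (x < r%:E)%E]); apply: open_ereal_lt'; rewrite lte_fin.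
near=> l.
have h1 : `|pr M B - cexp l setT \1_B| < r by near: l.
have h2 : `|1 - pr (nuF l) (before_return T (A l) (tau l))| < r by near: l.
have h3 : (dP (nuF l) (condm (nu l) (S l)) < r%:E)%E by near: l.
have h4 : `|pr (push T (tau l) (nuF l)) (C l) - pr mu (C l)| <= r.
  have := KF l; set p := push _ _ _; move: p; near: l; exact: uni.
have h5 := nuA l _ (mS l); have h6 := nuA l _ (mSC l).
rewrite AS -qE in h5; rewrite setIA AS -xE in h6.
have nS : 0 < pr (nu l) (S l).
  by move: h1 h5; rewrite !ltr_norml => /andP[? ?] /andP[? ?]; lra.
have PS := Probs_condm mu _ _ (Pnu l) (mS l) nS.
have h7 := le_lt_trans (dP_bound mu _ _ (C l) (PF l) PS (mC l)) h3.
rewrite lte_fin (pr_condm mu)// in h7.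
have [p [pE _]] := ProbsP _ _ (PF l).
(* The cylinder and its preimage under the stopped map agree wherever the stopping time precedes the
   return. *)
have h8 : `|pr (nuF l) (C l) - pr (push T (tau l) (nuF l)) (C l)| <= r.
  have mst := measurable_stopped T (tau l) mT (mtau l) (C l) (mC l).
  have mbr := measurable_before_return T (tau l) mT (mtau l) (A l) (mA l).
  rewrite /pr /push !pE//; rewrite -/(pr p (C l)) -/(pr p _).
  apply: (@le_trans _ _ (pr p (~` before_return T (A l) (tau l)))).
    apply: pr_symdiff => //; first exact: measurableC.
    by move=> x /contrapT; exact: cyl_before.
  rewrite pr_setC//; move: h2; rewrite /pr pE// -/(pr p _).
  by rewrite ltr_norml => /andP[_ /ltW].
have [n1 n0] : pr (nu l) (S l) <= 1 /\ 0 <= pr (nu l) (S l `&` C l).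
  have [pn [pnE _]] := ProbsP _ _ (Pnu l).
  by rewrite /pr !pnE// -!/(pr pn _); split; [exact: pr_le1|exact: pr_ge0].
(* One r each for the perturbed conditional measure, the stopping, and the uniform estimate on K. *)
have h9 : `|pr (nu l) (S l `&` C l) - pr (nu l) (S l) * pr mu (C l)| <= 3 * r.
  set z := (pr (nu l) (S l))^-1 * _ in h7.
  have -> : pr (nu l) (S l `&` C l) = pr (nu l) (S l) * z.
    by rewrite /z mulVKf// gt_eqF.
  rewrite -mulrBr normrM gtr0_norm//.
  have : `|z - pr mu (C l)| <= 3 * r.
    move: h7 h8 h4; rewrite !ler_norml => h7 /andP[h8 h8'] /andP[h4 h4'].
    have : `|pr (nuF l) (C l) - z| <= r by have := normr_ge0 (pr (nuF l) (C l) - z); lra.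
    by rewrite ler_norml => /andP[? ?]; apply/andP; split; lra.
  have := normr_ge0 (z - pr mu (C l)); nra.
have /andP[c0 c1] := c01 l.
rewrite sub0r normrN.
move: h1 h5 h6 h9; rewrite !ltr_norml ler_norml => /andP[h1 h1'] /andP[h5 h5'].
move=> /andP[h6 h6'] /andP[h9 h9'].
by apply/andP; split; nra.
Unshelve. all: by end_near.
Qed.

Lemma cexp_cyl C (Bs : seq (set F)) : contset M C ->
  (forall B, B \in Bs -> measurable (B : set (borelT F))) ->
  cexp l (cyl T (A l) (psiA l) Bs) \1_C - pr M C * pr mu (cyl T (A l) (psiA l) Bs)
    @[l --> \oo] --> (0 : R).
Proof.
move=> cC mBs; have mcyl l : measurable (cyl T (A l) (psiA l) Bs) by exact: measurable_cyl.
apply: cexp_extend => // [l|B BB]; first by rewrite pr_ge0 pr_le1.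
exact: cexp_Bpi.
Qed.

Lemma cyl_cvg (Bs : seq (set F)) : (forall B, B \in Bs -> contset M B) ->
  pr mu (cyl T (A l) (psiA l) Bs) @[l --> \oo] --> \prod_(B <- Bs) pr M B.
Proof.
elim: Bs => [_|B Bs IH cBs].
  by rewrite big_nil /= pr_setT; exact: cvg_cst.
have cBs' C : C \in Bs -> contset M C by move=> CB; apply: cBs; rewrite in_cons CB orbT.
have mBs C : C \in Bs -> measurable (C : set (borelT F)) by move=> /cBs'[].
have mBBs C : C \in B :: Bs -> measurable (C : set (borelT F)) by move=> /cBs[].
have cB : contset M B by apply: cBs; rewrite mem_head.
have mB : measurable (B : set (borelT F)) by case: cB.
have h1 : cexp l (cyl T (A l) (psiA l) Bs) \1_B @[l --> \oo] -->
    pr M B * \prod_(B <- Bs) pr M B.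
  apply: cvgr_eq (cvgD (cexp_cyl B Bs cB mBs) (cvgM (cvg_cst (pr M B)) (IH cBs'))).
    by move=> l /=; rewrite subrK.
  by rewrite add0r.
(* The whole space as the set makes the masses of the longer cylinder under mu_A and mu
   asymptotically equal; by [pr_induced] the former is the quantity in [h1]. *)
have h2 := cexp_cyl setT (B :: Bs) (contsetT M) mBBs.
rewrite big_cons.
apply: cvgr_eq (cvgB h1 h2); last by rewrite subr0.
move=> l; transitivity (cexp l (cyl T (A l) (psiA l) Bs) \1_B -
  (cexp l (cyl T (A l) (psiA l) (B :: Bs)) \1_setT -
   pr M setT * pr mu (cyl T (A l) (psiA l) (B :: Bs)))) => //.
have mc := measurable_cyl l Bs mBs; have mc' := measurable_cyl l (B :: Bs) mBBs.
rewrite (cexp_indic l _ B mc mB) (cexp_indic l _ setT mc' measurableT).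
rewrite preimage_setT setIT pr_setT mul1r [X in pr mu (A l `&` X)]/= pr_induced//.
- by rewrite opprB addrC subrK.
- by apply: measurableI => //; apply: measurableI => //; exact: mphiB.
- by move=> x [[]].
Qed.

Lemma cexp_cyl_cvg B (Bs : seq (set F)) : (forall C, C \in B :: Bs -> contset M C) ->
  cexp l (cyl T (A l) (psiA l) Bs) \1_B @[l --> \oo] -->
    \prod_(C <- B :: Bs) pr M C.
Proof.
move=> cBBs; have cB : contset M B by apply: cBBs; rewrite mem_head.
have cBs C : C \in Bs -> contset M C by move=> CB; apply: cBBs; rewrite in_cons CB orbT.
have mBs C : C \in Bs -> measurable (C : set (borelT F)) by move=> /cBs[].
apply: cvgr_eq (cvgD (cexp_cyl B Bs cB mBs) (cvgM (cvg_cst (pr M B)) (cyl_cvg Bs cBs))).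
  by move=> l /=; rewrite subrK.
by rewrite add0r big_cons.
Qed.

Let visits l := visits_io T (A l).

Let mvisits l : measurable (visits l).
Proof. exact: measurable_visits_io. Qed.

Let visits1 l : pr mu (visits l) = 1.
Proof. exact: pr_visits_io. Qed.

Lemma process_rect l n B : (forall j, contset M (B j)) ->
  visits l `&` local_process T (A l) (psiA l) @^-1` (rect n B) =
  visits l `&` cyl T (A l) (psiA l) (mkseq B n.+1).
Proof.
move=> cB; apply/seteqP; split=> x [Vx h]; split => //.
  apply/(cyl_visits _ _ _ _ _ Vx) => j; rewrite size_mkseq => jn.
  by rewrite nth_mkseq//; exact: h.
move=> j jn; move/(cyl_visits _ _ _ _ _ Vx) : h => /(_ j).
by rewrite size_mkseq nth_mkseq// ltnS jn => /(_ isT).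
Qed.

(** On A the process starts with psi_A at the point itself and continues as [local_process], so the
    cylinder carries the sides from index 1 on. *)
Lemma process0_rect l n B : (forall j, contset M (B j)) ->
  (A l `&` visits l) `&` local_process0 T (A l) (psiA l) @^-1` (rect n B) =
  visits l `&` ((A l `&` (psiA l \_ (A l)) @^-1` (B 0%N)) `&`
    cyl T (A l) (psiA l) (mkseq (fun j => B j.+1) n)).
Proof.
move=> cB; have ph x : A l x -> (psiA l \_ (A l)) x = psiA l x by move=> Ax; rewrite patchE mem_set.
apply/seteqP; split=> x.
  move=> [[Ax Vx] h]; split => //; split.
    by split => //; rewrite /preimage/= ph//; exact: (h 0%N).
  apply/(cyl_visits _ _ _ _ _ Vx) => j; rewrite size_mkseq => jn.
  by rewrite nth_mkseq//; exact: (h j.+1).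
move=> [Vx [[Ax B0] h]]; split => // -[_|j jn]; first by move: B0; rewrite /preimage/= ph.
move/(cyl_visits _ _ _ _ _ Vx) : h => /(_ j).
by rewrite size_mkseq nth_mkseq// => /(_ jn).
Qed.

Lemma contset_mkseq (B : nat -> set F) n : (forall j, contset M (B j)) ->
  forall C, C \in mkseq B n -> contset M C.
Proof. by move=> cB C /mapP[j _ ->]. Qed.

Lemma measurable_contset_mkseq (B : nat -> set F) n : (forall j, contset M (B j)) ->
  forall C, C \in mkseq B n -> measurable (C : set (borelT F)).
Proof. by move=> cB C /contset_mkseq-/(_ cB)[]. Qed.

Context {dO : measure_display} {Om : measurableType dO} (P : probability Om R)
  (Y : Om -> nat -> F).
Hypothesis mY : forall j, measurable_fun setT ((fun w => Y w j) : Om -> borelT F).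
Hypothesis PY : forall n (B : nat -> set F), (forall j, contset M (B j)) ->
  pr P (Y @^-1` (rect n B)) = \prod_(C <- mkseq B n.+1) pr M C.

Lemma measurable_rect_Y E : rects M E -> measurable (setT `&` Y @^-1` E).
Proof.
move=> [n [B [cB ->]]]; rewrite setTI.
have -> : Y @^-1` (rect n B) = \bigcap_(j in [set j | (j <= n)%N])
    ((fun w => Y w j) @^-1` (B j)).
  by apply/seteqP; split=> w h j; exact: h.
apply: bigcap_measurable; first by exists 0%N.
move=> j _; rewrite -[X in measurable X]setTI; apply: mY => //.
by case: (cB j).
Qed.

Lemma process_limit (f : {ptws nat -> F} -> R) : continuous f ->
  ((fun l => cond_int mu (A l) (fun x => f (local_process0 T (A l) (psiA l) x)))
     @ \oo --> (\int[P]_w (f (Y w))%:E)%E) /\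
  ((fun l => (\int[mu]_x (f (local_process T (A l) (psiA l) x))%:E)%E)
     @ \oo --> (\int[P]_w (f (Y w))%:E)%E).
Proof.
move=> cf.
have mP l E : rects M E ->
    measurable (visits l `&` local_process T (A l) (psiA l) @^-1` E).
  move=> [n [B [cB ->]]]; rewrite process_rect//; apply: measurableI => //.
  by apply: measurable_cyl; exact: measurable_contset_mkseq.
have mP0 l E : rects M E ->
    measurable ((A l `&` visits l) `&` local_process0 T (A l) (psiA l) @^-1` E).
  move=> [n [B [cB ->]]]; rewrite process0_rect//; apply: measurableI => //.
  apply: measurableI; last by apply: measurable_cyl; exact: measurable_contset_mkseq.
  by apply: measurableI => //; apply: mphiB; case: (cB 0%N).
have -> : (\int[P]_w (f (Y w))%:E)%E = (\int[P]_w (\1_setT w * f (Y w)))%:E.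
  rewrite (Rint_EFin P setT setT) ?pr_setT ?setIT//.
  exact: (bmf_continuous_rects M cF setT Y f measurable_rect_Y cf).
split.
  have AV1 l : pr mu (A l `&` visits l) = pr mu (A l) by rewrite setIC pr_full.
  have -> : (fun l => cond_int mu (A l) (fun x => f (local_process0 T (A l) (psiA l) x))) =
    (fun l => ((pr mu (A l))^-1 * \int[mu]_x (\1_(A l `&` visits l) x *
       f (local_process0 T (A l) (psiA l) x)))%:E).
    apply/funext => l; rewrite /cond_int (Rint_EFin mu (A l) (visits l))//; last first.
      exact: (bmf_continuous_rects M cF _ (local_process0 T (A l) (psiA l)) f (mP0 l) cf).
    exact: mul_inv_pr.
  apply/fine_cvgP; split; first exact: nearW.
  apply: (rects_limit M cF mu P (fun l => A l `&` visits l) (fun l => (pr mu (A l))^-1)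
    (fun l => local_process0 T (A l) (psiA l)) Y) => //.
  - by move=> l; rewrite invr_ge0 pr_ge0.
  - by move=> l; rewrite AV1 mulVf// gt_eqF.
  - exact: measurable_rect_Y.
  move=> _ [n [B [cB ->]]]; rewrite setTI PY//.
  have := cexp_cyl_cvg (B 0%N) (mkseq (fun j => B j.+1) n) _.
  have -> : mkseq B n.+1 = B 0%N :: mkseq (fun j => B j.+1) n.
    by rewrite /mkseq/= (iotaDl 1 0) -map_comp.
  move=> h; apply: cvgr_eq (h _) => //; last first.
    by move=> C; rewrite in_cons => /predU1P[->//|]; exact: contset_mkseq.
  move=> l; rewrite process0_rect//.
  have mc : measurable (cyl T (A l) (psiA l) (mkseq (fun j => B j.+1) n)).
    by apply: measurable_cyl; exact: measurable_contset_mkseq.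
  have mB0 : measurable (B 0%N : set (borelT F)) by case: (cB 0%N).
  rewrite cexp_indic//; congr (_ * _); rewrite [RHS]pr_full//.
  by apply: measurableI => //; apply: measurableI => //; exact: mphiB.
have -> : (fun l => (\int[mu]_x (f (local_process T (A l) (psiA l) x))%:E)%E) =
  (fun l => (1 * \int[mu]_x (\1_(visits l) x * f (local_process T (A l) (psiA l) x)))%:E).
  apply/funext => l; rewrite (Rint_EFin mu setT (visits l)) ?setTI ?mul1r//.
  exact: (bmf_continuous_rects M cF _ (local_process T (A l) (psiA l)) f (mP l) cf).
apply/fine_cvgP; split; first exact: nearW.
apply: (rects_limit M cF mu P visits (fun=> 1) (fun l => local_process T (A l) (psiA l)) Y) => //.
- by move=> l; rewrite mul1r visits1.
- exact: measurable_rect_Y.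
move=> _ [n [B [cB ->]]]; rewrite setTI PY//.
apply: cvgr_eq (cyl_cvg (mkseq B n.+1) (contset_mkseq _ _ cB)) => // l.
rewrite mul1r process_rect// pr_full//.
by apply: measurable_cyl; exact: measurable_contset_mkseq.
Qed.

End main.

(** * Both versions of the theorem *)

Lemma law_of_random_element {R : realType} {d d' : measure_display}
  {Om : measurableType d} {Y : measurableType d'} (P : probability Om R) (psi : Om -> Y) :
  measurable_fun setT psi ->
  exists M : probability Y R, forall B, M B = P (psi @^-1` B).
Proof. by move=> mpsi; exists (distribution P (mfun_Sub (mem_set mpsi))). Qed.

Lemma cond_int_cexp {R : realType} {d : measure_display} {X : measurableType d}
  (mu : probability X R) {F : pseudoPMetricType R} (A : nat -> set X)
  (psiA : nat -> X -> F) l (f : F -> R) :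
  measurable (A l) -> 0 < pr mu (A l) ->
  measurable_fun (A l) (psiA l : X -> borelT F) -> bmf (f : borelT F -> R) ->
  cond_int mu (A l) (fun x => f (psiA l x)) = (cexp mu A psiA l setT f)%:E.
Proof.
move=> mA A0 mpsi bf.
have mphi : measurable_fun setT (psiA l \_ (A l) : X -> borelT F).
  exact: (measurable_restrictT (psiA l : X -> borelT F) mA).1 mpsi.
have E : (fun x => \1_(A l) x * f (psiA l x)) =
    (fun x => \1_(A l) x * f ((psiA l \_ (A l)) x)).
  apply/funext => x; have [Ax|Ax] := pselect (A l x); last by rewrite indic0N// !mul0r.
  by rewrite patchE mem_set.
rewrite /cond_int /cexp (Rint_EFin mu (A l) setT) ?pr_setT ?setIT//.
  by rewrite E; exact: mul_inv_pr.
rewrite E; apply: bmfM; first exact: bmf_indic.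
exact: (bmf_comp (f : borelT F -> R) (psiA l \_ (A l))).
Qed.

Theorem mainTheorem6
  (R : realType) (d : measure_display) (X : measurableType d)
  (mu : probability X R) (T : X -> X)
  (F : pseudoPMetricType R)
  (A : nat -> set X) (psiA : nat -> X -> F)
  (dO : measure_display) (Om : measurableType dO) (P : probability Om R)
  (psi : Om -> F)
  (Bpi : set (set F)) :
  (* (F, d_F) is a compact metric space *)
  hausdorff_space F -> compact [set: F] ->
  (* ergodic probability preserving system *)
  measure_preserving mu T -> ergodic mu T ->
  (* asymptotically rare sequence *)
  asymptotically_rare mu A ->
  (* local observables psi_{A_l} : A_l -> F, and the random element psi *)
  (forall l, measurable_fun (A l) (psiA l : X -> borelT F)) ->
  measurable_fun setT (psi : Om -> borelT F) ->
  (* psi_{A_l} ==> psi under mu_{A_l} *)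
  (forall f : F -> R, continuous f -> bounded_fun f ->
     (fun l => cond_int mu (A l) (fun x => f (psiA l x)))
       @ \oo --> (\int[P]_w (f (psi w))%:E)%E) ->
  (* Bpi is a pi-system generating the Borel sigma-algebra, F in Bpi *)
  Bpi setT -> setI_closed Bpi -> <<s Bpi >> = <<s @open F >> ->
  (* Pr[psi in boundary B] = 0 for B in Bpi *)
  (forall B, Bpi B -> P (psi @^-1` boundary B) = 0%E) ->
  let conclusion :=
    forall (dO' : measure_display) (Om' : measurableType dO')
      (P' : probability Om' R) (Ystar : Om' -> nat -> F),
      iid_with_law_of P' Ystar P psi ->
      forall f : {ptws nat -> F} -> R, continuous f -> bounded_fun f ->
        ((fun l => cond_int mu (A l)
              (fun x => f (local_process0 T (A l) (psiA l) x)))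
           @ \oo --> (\int[P']_w (f (Ystar w))%:E)%E) /\
        ((fun l => (\int[mu]_x (f (local_process T (A l) (psiA l) x))%:E)%E)
           @ \oo --> (\int[P']_w (f (Ystar w))%:E)%E) in
  (* first version: nu_l := mu_{A_l} *)
  ((forall B, Bpi B -> (0 < P (psi @^-1` B))%E ->
      exists tau : nat -> X -> nat,
        (forall l, measurable_fun setT (tau l)) /\
        ((fun l => condm (condm mu (A l)) (A l `&` psiA l @^-1` B)
                     (before_return T (A l) (tau l)))
           @ \oo --> 1%E) /\
        exists2 K : set (set X -> \bar R), compactP mu K &
          forall l, K (push T (tau l)
                         (condm (condm mu (A l)) (A l `&` psiA l @^-1` B))))
    -> conclusion)
  /\
  (* more general version *)
  ((forall eps : R, 0 < eps ->
      exists nu : nat -> set X -> \bar R,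
        [/\ forall l, Probs mu (nu l),
            forall l, (dP (nu l) (condm mu (A l)) < eps%:E)%E &
            forall B, Bpi B -> (0 < P (psi @^-1` B))%E ->
            exists2 K : set (set X -> \bar R), compactP mu K &
            exists nuF : nat -> set X -> \bar R,
            exists tau : nat -> X -> nat,
              [/\ forall l, Probs mu (nuF l),
                  (fun l => dP (nuF l) (condm (nu l) (A l `&` psiA l @^-1` B)))
                    @ \oo --> 0%E,
                  forall l, measurable_fun setT (tau l),
                  (fun l => nuF l (before_return T (A l) (tau l)))
                    @ \oo --> 1%E &
                  forall l, K (push T (tau l) (nuF l))]])
    -> conclusion).
Proof.
move=> hF cF mpT ergT [mA [A0 A_cvg]] mpsiA mpsi weak BpiT BpiI BpiE Bbd conclusion.
have [M ME] := law_of_random_element P (psi : Om -> borelT F) mpsi.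
have mBpi B : Bpi B -> measurable (B : set (borelT F)).
  by move=> BB; rewrite -[measurable _]/(<<s @open F >> B) -BpiE; exact: sub_gen_smallest.
have Apos l : 0 < pr mu (A l) by rewrite -lte_fin -prE.
have Acvg : pr mu (A l) @[l --> \oo] --> (0 : R) by rewrite /pr; exact: fine_cvg.
have weak' (f : F -> R) : continuous f -> bounded_fun f ->
    cexp mu A psiA l setT f @[l --> \oo] --> \int[M]_x f x.
  move=> cf bf; have mf := continuous_bmf f cf bf.
  have := weak f cf bf.
  have -> : (fun l => cond_int mu (A l) (fun x => f (psiA l x))) =
      (fun l => (cexp mu A psiA l setT f)%:E).
    by apply/funext => l; exact: cond_int_cexp.
  have bfp : bmf (fun w => f (psi w)) by exact: (bmf_comp (f : borelT F -> R) (psi : Om -> borelT F)).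
  have -> : (\int[P]_w (f (psi w))%:E)%E = (\int[M]_x f x)%:E.
    rewrite (Rint_push P M (psi : Om -> borelT F))//.
    rewrite (Rint_EFin P setT setT) ?pr_setT ?setIT//.
      by congr (_%:E); apply: eq_Rintegral => w _; rewrite indicT mul1r.
    by apply: bmfM => //; exact: bmf_indic.
  by move=> /fine_cvgP[].
have Bbd' B : Bpi B -> pr M (boundary B) = 0.
  by move=> BB; rewrite /pr ME Bbd.
have PM B : measurable (B : set (borelT F)) -> (0 < P (psi @^-1` B))%E <-> 0 < pr M B.
  by move=> mB; rewrite -ME prE// lte_fin.
have second : (forall eps : R, 0 < eps ->
      exists nu : nat -> set X -> \bar R,
        [/\ forall l, Probs mu (nu l),
            forall l, (dP (nu l) (condm mu (A l)) < eps%:E)%E &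
            forall B, Bpi B -> (0 < P (psi @^-1` B))%E ->
            exists2 K : set (set X -> \bar R), compactP mu K &
            exists nuF : nat -> set X -> \bar R,
            exists tau : nat -> X -> nat,
              [/\ forall l, Probs mu (nuF l),
                  (fun l => dP (nuF l) (condm (nu l) (A l `&` psiA l @^-1` B)))
                    @ \oo --> 0%E,
                  forall l, measurable_fun setT (tau l),
                  (fun l => nuF l (before_return T (A l) (tau l)))
                    @ \oo --> 1%E &
                  forall l, K (push T (tau l) (nuF l))]]) -> conclusion.
  move=> H dO' Om' P' Y [mY lawY indY] f cf _.
  apply: (process_limit mu T A psiA M Bpi) => //.
    move=> e e0; have [nu [Pnu dnu hnu]] := H e e0; exists nu; split => // B BB MB.
    by apply: hnu => //; apply/PM => //; exact: mBpi.
  move=> n B cB; rewrite /pr.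
  have -> : Y @^-1` (rect n B) = [set w | forall j, j \in iota 0 n.+1 -> B j (Y w j)].
    apply/seteqP; split=> w h j; first by rewrite mem_iota add0n ltnS => /h.
    by move=> jn; apply: h; rewrite mem_iota add0n ltnS.
  have mB j : measurable (B j : set (borelT F)) by case: (cB j).
  rewrite indY ?iota_uniq// /mkseq big_map.
  rewrite (eq_bigr (fun j => (pr M (B j))%:E)); last first.
    by move=> j _; rewrite lawY// -prE// ME.
  by rewrite -(big_morph EFin (@EFinM R) erefl).
(* The first version is the instance in which both distances in the general one are 0. *)
split => // H; apply: second => e e0.
have Pmu := Probs_self mu.
have PA l : Probs mu (condm mu (A l)) by exact: Probs_condm.
exists (fun l => condm mu (A l)); split => //.
  by move=> l; rewrite (dPxx mu)// lte_fin.
move=> B BB PB; have [tau [mtau [hbr [K cK KF]]]] := H B BB PB.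
have mS l : measurable (A l `&` psiA l @^-1` B) by apply: mpsiA => //; exact: mBpi.
have PS l : Probs mu (condm (condm mu (A l)) (A l `&` psiA l @^-1` B)).
  apply: Probs_condm => //; rewrite lt_neqAle eq_sym; apply/andP; split; last first.
    by have [p [pE _]] := ProbsP _ _ (PA l); rewrite /pr pE// -/(pr p _) pr_ge0.
  (* The pushed measure lies in K, hence has total mass 1, which rules out conditioning on a null
     event. *)
  apply/eqP => S0; have [_ _ _ /condm_neq0] := (cK.1 _ (KF l)).
  by rewrite (Probs_prE mu _ _ (PA l))// S0.
exists K => //; exists (fun l => condm (condm mu (A l)) (A l `&` psiA l @^-1` B)), tau.
split => //.
rewrite (_ : (fun l => _) = (fun=> 0%E)); first exact: cvg_cst.
by apply/funext => l; rewrite (dPxx mu).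
Qed.
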